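(* Let $D\subset\mathbb{R}^2$ be a nonempty bounded open set. Then both sequences $\big(\mathcal{R}(nD\cap\mathbb{Z}^2)\big)_{n}$ and $\big(\mathcal{V}(nD\cap\mathbb{Z}^2)\big)_{n}$ (defined for all $n\ge1$ such that $nD\cap\mathbb{Z}^2\neq\emptyset$, in particular for all sufficiently large $n$) converge in distribution, as $n\to\infty$, to a random variable uniformly distributed on $[0,1]$.
   Context: For $x,y\in\mathbb{Z}^2$ write $x\sim y$ if $x$ and $y$ are nearest neighbours in $\mathbb{Z}^2$. Let $(S_k)_{k\ge0}$ be the simple random walk on $\mathbb{Z}^2$ (transition probability $1/4$ to each neighbour). Its potential kernel is $$a(x)=\sum_{k=0}^\infty\big(\mathbb{P}_0[S_k=0]-\mathbb{P}_x[S_k=0]\big),\qquad x\in\mathbb{Z}^2,$$ where $\mathbb{P}_x$ is the law of the walk started at $x$; the series converges, $a(0)=0$, $a(x)>0$ for $x\ne0$, $a(x)=1$ for $x\sim 0$, and $\frac14\sum_{y\sim x}a(y)=a(x)$ for all $x\neq 0$. The conditioned walk $(\widehat S_k)_{k\ge 0}$ is the Markov chain on $\mathbb{Z}^2\setminus\{0\}$ with transition probabilities $\widehat P_{xy}=\frac{a(y)}{4a(x)}$ if $x\sim y$ (and $x\ne 0$), and $\widehat P_{xy}=0$ otherwise. It is started at a fixed neighbour $x_0$ of the origin. Its range is $\widehat S_{[0,\infty)}=\bigcup_{m\ge0}\{\widehat S_m\}$. For nonempty finite $A\subset\mathbb{Z}^2$ put $$\mathcal{R}(A)=\frac{|A\cap\widehat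 S_{[0,\infty)}|}{|A|},\qquad \mathcal{V}(A)=\frac{|A\setminus\widehat S_{[0,\infty)}|}{|A|}=1-\mathcal{R}(A).$$ For $D\subset\mathbb{R}^2$, $nD=\{nx:x\in D\}$. *)

(* Defs.v *)
From HB Require Import structures.
From mathcomp Require Import all_boot all_order all_algebra.
From mathcomp Require Import finmap.
From mathcomp Require Import all_classical all_reals all_analysis.

Set Implicit Arguments.
Unset Strict Implicit.
Unset Printing Implicit Defensive.

Import Order.TTheory GRing.Theory Num.Theory.
Import numFieldNormedType.Exports.

Local Open Scope classical_set_scope.
Local Open Scope ring_scope.

Notation lattice := (int * int)%type.
Notation punctured_lattice := {x : lattice | x != 0}.

Definition neighbours (x y : lattice) : bool :=
  `|x.1 - y.1| + `|x.2 - y.2| == 1.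

(* Under P, (S_k) is a time-homogeneous Markov chain on the countable state
   space E with transition probabilities p, started at x0. The Markov property
   P[S_{n+1} = y_{n+1} | S_0 = y_0, .., S_n = y_n] = p y_n y_{n+1} is written in
   product form, so that it is meaningful (and trivial) for conditioning events
   of probability 0. *)
Record is_markov_chain (R : realType) (d : measure_display)
    (T : measurableType d) (P : probability T R) (E : countType)
    (p : E -> E -> R) (x0 : E) (S : nat -> T -> E) : Prop := MarkovChain {
  markov_measurable : forall k x, measurable (S k @^-1` [set x]) ;
  markov_start : P (S 0%N @^-1` [set x0]) = 1%E ;
  markov_step : forall (y : nat -> E) (n : nat),
    P [set w | forall i, (i <= n.+1)%N -> S i w = y i] =
    (P [set w | forall i, (i <= n)%N -> S i w = y i] *
     (p (y n) (y n.+1))%:E)%E }.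

Definition srw_transition (R : realType) (x y : lattice) : R :=
  if neighbours x y then 4^-1 else 0.

(* Under Q x, S is the simple random walk started at x. *)
Definition is_simple_random_walk (R : realType) (d : measure_display)
    (T : measurableType d) (Q : lattice -> probability T R)
    (S : nat -> T -> lattice) : Prop :=
  forall x, is_markov_chain (Q x) (@srw_transition R) x S.

Definition potential_kernel (R : realType) (d : measure_display)
    (T : measurableType d) (Q : lattice -> probability T R)
    (S : nat -> T -> lattice) (x : lattice) : R :=
  limn (series (fun k : nat => fine (Q 0 (S k @^-1` [set 0])) -
                               fine (Q x (S k @^-1` [set 0])))).

Definition conditioned_transition (R : realType) (a : lattice -> R)
    (x y : punctured_lattice) : R :=
  if neighbours (val x) (val y) then a (val y) / (4 * a (val x)) else 0.

Definition walk_range (T : Type) (S : nat -> T -> punctured_lattice) (w : T) :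
    set lattice :=
  [set val (S m w) | m in [set: nat]].

(* [fset_set] turns a finite set into the corresponding {fset _}; it is the
   empty set on infinite sets, so these are only meaningful for finite A. *)
Definition visited_fraction (R : realType) (T : Type)
    (S : nat -> T -> punctured_lattice) (A : set lattice) (w : T) : R :=
  #|` fset_set (A `&` walk_range S w)|%:R / #|` fset_set A|%:R.

Definition vacant_fraction (R : realType) (T : Type)
    (S : nat -> T -> punctured_lattice) (A : set lattice) (w : T) : R :=
  #|` fset_set (A `\` walk_range S w)|%:R / #|` fset_set A|%:R.

Definition dilated_lattice_points (R : realType) (D : set (R * R)) (n : nat) :
    set lattice :=
  [set z | [set n%:R *: x | x in D] (z.1%:~R, z.2%:~R)].

Definition cvg_in_distribution (R : realType) (d : measure_display)
    (T : measurableType d) (P : probability T R) (X : nat -> T -> R)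
    (mu : probability (measurableTypeR R) R) : Prop :=
  (forall n, measurable_fun [set: T] (X n)) /\
  forall r : R, {for r, continuous (fun t : R => mu [set` `]-oo, t]])} ->
    P (X n @^-1` [set` `]-oo, r]]) @[n --> \oo] --> mu [set` `]-oo, r]].

(* Main.v *)
Require Import Defs.
From HB Require Import structures.
From mathcomp Require Import all_boot all_order all_algebra.
From mathcomp Require Import finmap.
From mathcomp Require Import all_classical all_reals all_analysis.
From mathcomp Require Import measurable_realfun.
From mathcomp Require Import zify ring lra.

(** Write [a] for the potential kernel of the simple random walk. The proof is
    the method of moments for the vacant fraction V_n of the points of nD.

    The k-th moment of V_n is the average, over k-tuples of points of nD, of
    the probability that the conditioned walk visits none of them. Conditioning
    is the Doob transform by [a], so that the avoidance probability is u(x0) / a(x0)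
    for the function u that equals the limit of the iterates of the neighbour
    mean, started from [a] and reset to 0 on the tuple Y and at the origin
    ([pr_avoids]). Let
      g_y(x) = a(x) + a(y) - a(x - y)
    be the Green function of the walk killed at 0. It is bounded, nonnegative,
    and harmonic off {0, y}. Comparison through a minimum principle squeezes u
    between two functions of the form a - c * sum_(y in Y) g_y, where the
    constant c only has to make the sign right on Y ([avoid_lim_ge],
    [avoid_lim_le_green]). When the points of Y and their mutual differences all
    have size of order n, every value of [a] involved is L + O(1) for one number
    L that grows with n, and a(y - x0) - a(y) tends to 0. Hence sum_y g_y is
    about (k + 1) L at each point of Y, [a] is about L there, the constant c is
    about 1 / (k + 1), and sum_y g_y(x0) is about k: the walk avoids Y with
    probability close to 1 - k / (k + 1) = 1 / (k + 1) ([avoid_asymp]). This is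
    the k-th moment of the uniform law. The tuples of nD that are not separated
    at scale n are a small proportion because D contains a square and is
    bounded ([dilated_density], [bad_ktuples]).

    What is needed of [a] comes from the rotation by 45 degrees, in which the
    walk is a pair of independent one-dimensional walks: its return
    probabilities are products of binomial weights, for which a ratio identity
    gives all the estimates ([walk1_absorb], [betaS]).

    Moments determine the limit law because polynomials of the form
    (1 - x^n)^N approximate the indicators of the intervals [0, r]
    ([threshold_poly], [moments_to_uniform]). *)

Set Implicit Arguments.
Unset Strict Implicit.
Unset Printing Implicit Defensive.

Import Order.TTheory GRing.Theory Num.Theory.
Import numFieldNormedType.Exports.

Local Open Scope classical_set_scope.
Local Open Scope ring_scope.

(** * The one-dimensional walk and sums of return probabilities *)

Section OneDim.
Variable R : realFieldType.

Fixpoint walk1 (k : nat) (m : int) : R :=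
  if k is k'.+1 then (walk1 k' (m - 1) + walk1 k' (m + 1)) / 2
  else (m == 0)%:R.

Lemma walk1S k m : walk1 k.+1 m = (walk1 k (m - 1) + walk1 k (m + 1)) / 2.
Proof. by []. Qed.

Lemma walk1_ge0 k m : 0 <= walk1 k m.
Proof.
elim: k m => [|k IH] m /=; first by case: eqP.
by have := IH (m - 1); have := IH (m + 1); lra.
Qed.

Lemma walk1N k m : walk1 k (- m) = walk1 k m.
Proof.
elim: k m => [|k IH] m /=; first by rewrite oppr_eq0.
rewrite -[walk1 k (- m - 1)]IH -[walk1 k (- m + 1)]IH.
have -> : - (- m - 1) = m + 1 by ring.
have -> : - (- m + 1) = m - 1 by ring.
by rewrite addrC.
Qed.

Lemma walk1_absz k m : walk1 k `|m|%:Z = walk1 k m.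
Proof. by rewrite abszE; case: (ger0P m) => // _; rewrite walk1N. Qed.

(** The position has the parity of the time, so the positions [k + 1 + 2 * t]
    are never occupied at time [k]. *)
Lemma walk1_parity k (t : int) : walk1 k (k%:Z + 1 + 2 * t) = 0.
Proof.
elim: k t => [|k IH] t /=; first by case: eqP => //; lia.
have -> : k.+1%:Z + 1 + 2 * t - 1 = k%:Z + 1 + 2 * t by lia.
have -> : k.+1%:Z + 1 + 2 * t + 1 = k%:Z + 1 + 2 * (t + 1) by lia.
by rewrite !IH addr0 mul0r.
Qed.

Lemma walk1_far k (m : int) : (k < `|m|)%N -> walk1 k m = 0.
Proof.
elim: k m => [|k IH] m hm /=; first by case: eqP => // m0; move: hm; rewrite m0.
by rewrite !IH ?addr0 ?mul0r //; lia.
Qed.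

(** The absorption identity (n + m) p_n(m) = n p_(n-1)(m - 1) of binomial
    weights. It is proved from the recursion of the walk, which is what links
    [walk1] to the Markov property, and is the only exact input on binomials. *)
Lemma walk1_absorb k (m : int) :
  (k.+1%:R + m%:~R) * walk1 k.+1 m = k.+1%:R * walk1 k (m - 1).
Proof.
elim: k m => [|k IH] m.
  rewrite /=; case: (eqVneq m 1) => [->|m1] /=.
    by rewrite /=; lra.
  case: (eqVneq m (-1)) => [->|m2] /=; first by rewrite /=; lra.
  have -> : (m - 1 == 0) = false by lia.
  have -> : (m + 1 == 0) = false by lia.
  by rewrite addr0 mul0r !mulr0.
rewrite [walk1 k.+2 m]walk1S.
have h1 := IH (m - 1); have h2 := IH (m + 1).
rewrite addrK in h2.
have e : walk1 k.+1 (m - 1) = (walk1 k (m - 1 - 1) + walk1 k m) / 2.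
  by rewrite walk1S subrK.
have -> : k.+2%:R = k.+1%:R + 1 :> R by rewrite -natr1.
rewrite !intrD !intrN /= in h1 h2.
set X := walk1 k.+1 (m - 1) in h1 e *; set Y := walk1 k.+1 (m + 1) in h2 *.
have -> : (k.+1%:R + 1 + m%:~R) * ((X + Y) / 2)
  = ((k.+1%:R + (m%:~R - 1)) * X + (k.+1%:R + (m%:~R + 1)) * Y) / 2 + X.
  by field.
by rewrite h1 h2 e; field.
Qed.

Lemma walk1_absorbN k (m : int) :
  (k.+1%:R - m%:~R) * walk1 k.+1 m = k.+1%:R * walk1 k (m + 1).
Proof.
by rewrite -(walk1N k.+1 m) -(walk1N k (m + 1)) opprD -walk1_absorb intrN.
Qed.

(** Only even times and even positions matter for the potential kernel at
    points of even parity. *)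
Definition beta (j i : nat) : R := walk1 (2 * j) (2 * i%:Z).

Lemma beta_ge0 j i : 0 <= beta j i.
Proof. exact: walk1_ge0. Qed.

Lemma beta_far j i : (j < i)%N -> beta j i = 0.
Proof. by move=> ji; apply: walk1_far; lia. Qed.

Lemma betaS j i : (j%:R + i%:R + 1) * beta j i.+1 = (j%:R - i%:R) * beta j i.
Proof.
case: j => [|j].
  rewrite (@beta_far 0 i.+1) // mulr0; case: i => [|i]; first by rewrite subrr mul0r.
  by rewrite beta_far // mulr0.
have e : (2 * j.+1 = (2 * j).+1.+1)%N by lia.
have h1 := walk1_absorb (2 * j).+1 (2 * i.+1%:Z).
have h2 := walk1_absorbN (2 * j).+1 (2 * i%:Z).
have e1 : 2 * i.+1%:Z - 1 = 2 * i%:Z + 1 by lia.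
rewrite e1 -h2 -e -!/(beta _ _) in h1.
rewrite !intrM in h1.
have ei : (i.+1%:~R : R) = i%:R + 1 by rewrite natr1.
have ei' : (i%:~R : R) = i%:R by [].
have ej : ((2 * j.+1)%:R : R) = 2 * j.+1%:R by rewrite natrM.
rewrite ei ei' ej in h1.
have := h1; lra.
Qed.

Lemma beta_decr j i : beta j i.+1 <= beta j i.
Proof.
have j0 : (0 : R) <= j%:R by [].
have i0 : (0 : R) <= i%:R by [].
have h := betaS j i; have b0 := beta_ge0 j i.
have p0 : 0 < j%:R + i%:R + 1 :> R by lra.
rewrite -(ler_pM2l p0) h; apply: ler_wpM2r => //; lra.
Qed.

(** Summing these increments gives [beta_second_moment], [beta_flat] and
    [ksum_grad]. *)
Lemma beta_drop j i :
  beta j i - beta j i.+1 = beta j i * (2 * i%:R + 1) / (j%:R + i%:R + 1).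
Proof.
have j0 : (0 : R) <= j%:R by [].
have i0 : (0 : R) <= i%:R by [].
have h := betaS j i.
have p0 : j%:R + i%:R + 1 != 0 :> R by lra.
by apply: (mulIf p0); rewrite divfK //; move: h; lra.
Qed.

Lemma beta00 : beta 0 0 = 1.
Proof. by []. Qed.

Lemma beta0S j : beta j.+1 0 = beta j 0 * (2 * j%:R + 1) / (2 * j%:R + 2).
Proof.
have h := walk1_absorb (2 * j) 1.
have e : (2 * j.+1 = (2 * j).+1.+1)%N by lia.
rewrite /beta e -[2 * 0%:Z]/(0 : int) walk1S sub0r add0r walk1N.
rewrite subrr in h; clear e.
have p0 : (0 : R) <= j%:R by [].
have p1 : 2 * j%:R + 2 != 0 :> R by lra.
apply: (mulIf p1); rewrite divfK //.
have ej : ((2 * j).+1%:R : R) = 2 * j%:R + 1 by rewrite -natr1 natrM.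
rewrite ej in h.
move: h; rewrite -[1%:~R]/(1 : R); lra.
Qed.

Lemma beta0_gt0 j : 0 < beta j 0.
Proof.
elim: j => [|j IH]; first by rewrite beta00.
have p0 : (0 : R) <= j%:R by [].
by rewrite beta0S divr_gt0 ?mulr_gt0 //; lra.
Qed.

Lemma beta0_drop j : beta j 0 - beta j.+1 0 = beta j 0 / (2 * j%:R + 2).
Proof.
have p0 : (0 : R) <= j%:R by [].
by rewrite beta0S; field; lra.
Qed.

(** [beta j 0 ^+ 2 * (2 * j + 1)] decreases with [j] (Wallis); its companion
    [beta0_sqr_ge] comes from the increasing [j * beta j 0 ^+ 2]. *)
Lemma beta0_sqr_le j : beta j 0 ^+ 2 * (2 * j%:R + 1) <= 1.
Proof.
elim: j => [|j IH]; first by rewrite beta00; lra.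
have p0 : (0 : R) <= j%:R by [].
have -> : j.+1%:R = j%:R + 1 :> R by rewrite natr1.
have -> : beta j.+1 0 ^+ 2 * (2 * (j%:R + 1) + 1) =
   (beta j 0 ^+ 2 * (2 * j%:R + 1)) *
   ((2 * j%:R + 1) * (2 * j%:R + 3) / (2 * j%:R + 2) ^+ 2).
  by rewrite beta0S; field; lra.
have p1 : 0 < 2 * j%:R + 2 :> R by lra.
have p2 : 0 < (2 * j%:R + 2) ^+ 2 :> R by exact: exprn_gt0.
have h1 : 0 <= beta j 0 ^+ 2 * (2 * j%:R + 1).
  by apply: mulr_ge0; [exact: sqr_ge0 | lra].
have h2 : 0 <= (2 * j%:R + 1) * (2 * j%:R + 3) / (2 * j%:R + 2) ^+ 2 :> R.
  by apply: divr_ge0; [apply: mulr_ge0; lra | exact: sqr_ge0].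
have h3 : (2 * j%:R + 1) * (2 * j%:R + 3) / (2 * j%:R + 2) ^+ 2 <= 1 :> R.
  by rewrite ler_pdivrMr // mul1r; lra.
exact: mulr_ile1.
Qed.

Lemma beta0_sqr_ge j : 1 <= 4 * j.+1%:R * beta j.+1 0 ^+ 2.
Proof.
elim: j => [|j IH]; first by rewrite beta0S beta00 mulr0 !add0r; lra.
apply: (le_trans IH).
have p0 : (0 : R) <= j.+1%:R by [].
have b0 := beta0_gt0 j.+1.
rewrite [beta j.+2 0]beta0S.
have -> : j.+2%:R = j.+1%:R + 1 :> R by rewrite natr1.
have -> : 4 * (j.+1%:R + 1) * (beta j.+1 0 * (2 * j.+1%:R + 1) / (2 * j.+1%:R + 2)) ^+ 2
  = beta j.+1 0 ^+ 2 * ((2 * j.+1%:R + 1) ^+ 2 / (j.+1%:R + 1)).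
  by field; lra.
rewrite [leLHS]mulrC; apply: ler_wpM2l; first exact: sqr_ge0.
have p : 0 < j.+1%:R + 1 :> R by lra.
rewrite ler_pdivlMr //; lra.
Qed.

Lemma beta_le0 j i : beta j i <= beta j 0.
Proof. by elim: i => [|i IH] //; apply: le_trans (beta_decr j i) IH. Qed.

(** Since [beta j] decreases, the drop from 0 to [i] is at least [beta j i]
    times a sum of [2 i' + 1] over [i' < i], divided by [2 j]: this plays the
    role of a Gaussian tail bound. *)
Lemma beta_second_moment j i : i%:R ^+ 2 * beta j i <= 2 * j%:R * beta j 0.
Proof.
case: (leqP i j) => [ij|ji]; last first.
  by rewrite beta_far // mulr0 mulr_ge0 ?beta_ge0 ?mulr_ge0.
suff : i%:R ^+ 2 * beta j i <= 2 * j%:R * (beta j 0 - beta j i).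
  move=> h; apply: le_trans h _; apply: ler_wpM2l; first exact: mulr_ge0.
  by rewrite gerBl beta_ge0.
elim: i ij => [|i IH] ij; first by rewrite subrr mulr0 expr2 !mul0r.
have {}IH := IH (ltnW ij).
have h := beta_drop j i; have d := beta_decr j i; have b := beta_ge0 j i.
have ij' : i%:R + 1 <= j%:R :> R by rewrite natr1 ler_nat.
have i0 : (0 : R) <= i%:R by [].
have p : 0 < j%:R + i%:R + 1 :> R by lra.
have h' : (beta j i - beta j i.+1) * (j%:R + i%:R + 1) = beta j i * (2 * i%:R + 1).
  by rewrite h divfK //; lra.
rewrite -natr1.
have : (i%:R + 1) ^+ 2 * beta j i.+1 <= (i%:R + 1) ^+ 2 * beta j i.
  by apply: ler_wpM2l => //; apply: sqr_ge0.
have : (beta j i - beta j i.+1) * (j%:R + i%:R + 1) <=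
       (beta j i - beta j i.+1) * (2 * j%:R).
  by apply: ler_wpM2l; lra.
rewrite h'; lra.
Qed.

(** By [beta_drop] each increment is at most [beta j 0 * (2 * i' + 1) / j],
    and the first [i] odd numbers sum to [i ^ 2]. *)
Lemma beta_flat j i : j%:R * (beta j 0 - beta j i) <= i%:R ^+ 2 * beta j 0.
Proof.
elim: i => [|i IH]; first by rewrite subrr mulr0 expr2 !mul0r.
have h := beta_drop j i; have d := beta_decr j i; have b := beta_le0 j i.
have i0 : (0 : R) <= i%:R by [].
have j0 : (0 : R) <= j%:R by [].
have h' : (beta j i - beta j i.+1) * (j%:R + i%:R + 1) = beta j i * (2 * i%:R + 1).
  by rewrite h divfK //; lra.
have k1 : beta j i * (2 * i%:R + 1) <= beta j 0 * (2 * i%:R + 1).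
  by apply: ler_wpM2r => //; lra.
have k2 : (beta j i - beta j i.+1) * j%:R <=
       (beta j i - beta j i.+1) * (j%:R + i%:R + 1).
  by apply: ler_wpM2l; lra.
rewrite -natr1; move: k1 k2 h' IH; lra.
Qed.

(** Multiply [beta_second_moment] by [beta j i] and use [beta0_sqr_le]. *)
Lemma beta_linear j i : i%:R * beta j i <= 1.
Proof.
have b := beta_ge0 j i.
have i0 : (0 : R) <= i%:R by [].
have p : 0 <= i%:R * beta j i by apply: mulr_ge0.
rewrite -(ler_pXn2r (ltn0Sn 1)) ?nnegrE // expr1n.
have h := beta_second_moment j i; have h2 := beta_le0 j i.
have h3 := beta0_sqr_le j; have b0 := beta0_gt0 j.
have : (i%:R ^+ 2 * beta j i) * beta j i <= (2 * j%:R * beta j 0) * beta j 0.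
  by apply: ler_pM => //; apply: mulr_ge0 => //; apply: sqr_ge0.
have : 0 <= beta j 0 ^+ 2 by apply: sqr_ge0.
move: h3; lra.
Qed.

Lemma beta_drop_le j i : beta j i - beta j i.+1 <= 3 / (j%:R + 1).
Proof.
have i0 : (0 : R) <= i%:R by [].
have j0 : (0 : R) <= j%:R by [].
have b := beta_ge0 j i.
rewrite beta_drop ler_pdivrMr; last by lra.
have h := beta_linear j i.
have h1 : beta j i <= 1.
  have := beta_le0 j i; have := beta0_sqr_le j; have := beta0_gt0 j; nra.
apply: (@le_trans _ _ 3); first by lra.
rewrite mulrAC ler_pdivlMr; nra.
Qed.

(** The planar walk at time [2j] is at the even point with half-coordinates
    [i], [l] with probability [beta j i * beta j l], so this is a term of the
    series of the potential kernel there; the terms of odd times vanish. *)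
Definition kterm (i l j : nat) : R := beta j 0 ^+ 2 - beta j i * beta j l.

(** The expected number of visits to the origin before time [2N]. It grows
    like a multiple of log N: it diverges [returns_unbounded] and varies
    slowly [returns_scale]. *)
Definition returns (N : nat) : R := \sum_(0 <= j < N) beta j 0 ^+ 2.

Definition ksum (i l N : nat) : R := \sum_(0 <= j < N) kterm i l j.

Lemma kterm_ge0 i l j : 0 <= kterm i l j.
Proof.
by rewrite subr_ge0 expr2; apply: ler_pM; rewrite ?beta_ge0 ?beta_le0.
Qed.

Lemma ksum_homo i l : {homo ksum i l : m n / (m <= n)%N >-> m <= n}.
Proof.
move=> m n mn; rewrite /ksum [leRHS](big_cat_nat (n := m)) //= lerDl.
by apply: sumr_ge0 => j _; apply: kterm_ge0.
Qed.

Lemma kterm_tail i l I j : (i <= I)%N -> (l <= I)%N -> (0 < j)%N ->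
  kterm i l j <= I%:R ^+ 2 / j%:R ^+ 2.
Proof.
move=> iI lI j0.
have hi := beta_flat j i; have hl := beta_flat j l.
have bi := beta_le0 j i; have bl := beta_le0 j l.
have b0 := beta0_gt0 j; have bi0 := beta_ge0 j i; have bl0 := beta_ge0 j l.
have J0 : (0 : R) < j%:R by rewrite ltr0n.
have h3 := beta0_sqr_le j.
have iI' : i%:R ^+ 2 <= I%:R ^+ 2 :> R by rewrite ler_pXn2r ?nnegrE ?ler_nat.
have lI' : l%:R ^+ 2 <= I%:R ^+ 2 :> R by rewrite ler_pXn2r ?nnegrE ?ler_nat.
have k1 : j%:R * kterm i l j <= 2 * I%:R ^+ 2 * beta j 0 ^+ 2.
  have -> : j%:R * kterm i l j = beta j 0 * (j%:R * (beta j 0 - beta j l))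
     + beta j l * (j%:R * (beta j 0 - beta j i)) by rewrite /kterm; ring.
  have a1 : beta j 0 * (j%:R * (beta j 0 - beta j l)) <= beta j 0 * (I%:R ^+ 2 * beta j 0).
    by apply: ler_wpM2l; [lra|apply: le_trans hl _; apply: ler_wpM2r=> //; lra].
  have a2 : beta j l * (j%:R * (beta j 0 - beta j i)) <= beta j 0 * (I%:R ^+ 2 * beta j 0).
    apply: ler_pM => //; first by apply: mulr_ge0; lra.
    by apply: le_trans hi _; apply: ler_wpM2r=> //; lra.
  lra.
rewrite ler_pdivlMr ?exprn_gt0 //.
have I0 : 0 <= I%:R ^+ 2 :> R by apply: sqr_ge0.
have k2 : I%:R ^+ 2 * (beta j 0 ^+ 2 * (2 * j%:R + 1)) <= I%:R ^+ 2 * 1.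
  by apply: ler_wpM2l.
have k3 : j%:R * (j%:R * kterm i l j) <= j%:R * (2 * I%:R ^+ 2 * beta j 0 ^+ 2).
  by apply: ler_wpM2l => //; lra.
have k4 : 0 <= I%:R ^+ 2 * beta j 0 ^+ 2 by apply: mulr_ge0 => //; apply: sqr_ge0.
lra.
Qed.

Lemma sum_inv_sqr (N J : nat) : (0 < N)%N -> (N <= J)%N ->
  \sum_(N <= j < J) (j%:R ^+ 2)^-1 <= 2 / N%:R - 2 / J%:R :> R.
Proof.
move=> N0; elim: J => [|J IH]; first by rewrite leqn0 => /eqP N0'; rewrite N0' in N0.
rewrite leq_eqVlt => /orP[/eqP <-|NJ]; first by rewrite big_geq // subrr.
rewrite big_nat_recr //=.
have {}IH := IH NJ.
have J0 : (1 : R) <= J%:R by rewrite ler1n; exact: leq_trans N0 NJ.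
suff : (J%:R ^+ 2)^-1 <= 2 / J%:R - 2 / J.+1%:R :> R.
  by move=> h; apply: le_trans (lerD IH h) _; rewrite addrA subrK.
rewrite -(natr1 J).
have -> : 2 / J%:R - 2 / (J%:R + 1) = 2 / (J%:R * (J%:R + 1)) :> R by field; lra.
have J1 : J%:R * 1 <= J%:R * J%:R :> R by apply: ler_wpM2l; lra.
have p1 : 0 < J%:R * (J%:R + 1) :> R by apply: mulr_gt0; lra.
have p2 : 0 < J%:R ^+ 2 :> R by apply: exprn_gt0; lra.
rewrite ler_pdivlMr // mulrC ler_pdivrMr //; lra.
Qed.

(** Up to time of order [I ^ 2] a term is at most the return probability, and
    later terms are summable by [kterm_tail] with a bound that does not depend
    on [I]. *)
Lemma ksum_le i l N : ksum i l N <= returns (maxn i l ^ 2) + 2.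
Proof.
set I := maxn i l.
case: (posnP I) => [I0|I0].
  have [i0 l0] : i = 0%N /\ l = 0%N by lia.
  rewrite /ksum big1 => [|j _]; last by rewrite /kterm i0 l0 expr2 subrr.
  by rewrite addr_ge0 // /returns sumr_ge0 // => j _; apply: sqr_ge0.
have I20 : (0 < I ^ 2)%N by rewrite expn_gt0 I0.
apply: (@le_trans _ _ (ksum i l (maxn (I ^ 2) N))).
  by apply: ksum_homo; rewrite leq_maxr.
rewrite /ksum (big_cat_nat (n := I ^ 2)) ?leq_maxl //=.
apply: lerD.
  apply: ler_sum => j _; rewrite /kterm gerBl.
  by apply: mulr_ge0; apply: beta_ge0.
apply: (@le_trans _ _ (\sum_(I ^ 2 <= j < maxn (I ^ 2) N) I%:R ^+ 2 * (j%:R ^+ 2)^-1)).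
  apply: ler_sum_nat => j /andP[Ij _]; apply: kterm_tail; rewrite ?leq_maxl ?leq_maxr //.
  exact: leq_trans Ij.
rewrite -mulr_sumr.
have h := sum_inv_sqr I20 (leq_maxl _ N).
apply: (@le_trans _ _ (I%:R ^+ 2 * (2 / (I ^ 2)%:R))).
  apply: ler_wpM2l; first exact: sqr_ge0.
  apply: le_trans h _; rewrite gerBl; exact: divr_ge0.
rewrite natrX mulrC divfK //.
by rewrite expf_neq0 // pnatr_eq0 -lt0n.
Qed.

Lemma beta_prod_le i l j :
  (maxn i l)%:R ^+ 2 * (beta j i * beta j l) <= 1.
Proof.
wlog il : i l / (i <= l)%N.
  move=> H; case/orP: (leq_total i l) => [/H //|/H].
  by rewrite maxnC [beta j l * _]mulrC.
rewrite (maxn_idPr il) mulrCA.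
have h := beta_second_moment j l; have h1 := beta_le0 j i.
have b0 := beta0_gt0 j; have bi0 := beta_ge0 j i; have bl0 := beta_ge0 j l.
have h3 := beta0_sqr_le j.
have : beta j i * (l%:R ^+ 2 * beta j l) <= beta j 0 * (2 * j%:R * beta j 0).
  by apply: ler_pM => //; apply: mulr_ge0 => //; apply: sqr_ge0.
have : 0 <= beta j 0 ^+ 2 by apply: sqr_ge0.
by move: h3; lra.
Qed.

(** The walk spends a bounded expected time at a point at distance [I] before
    time [I ^ 2], by [beta_prod_le]. *)
Lemma ksum_ge i l N : (maxn i l ^ 2 <= N)%N -> returns (maxn i l ^ 2) - 1 <= ksum i l N.
Proof.
set I := maxn i l => IN; apply: le_trans (ksum_homo i l IN).
rewrite /returns /ksum /kterm big_split /= sumrN lerD2l lerN2.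
case: (posnP I) => [->|I0]; first by rewrite big_geq.
have I1 : 0 < I%:R ^+ 2 :> R by rewrite exprn_gt0 // ltr0n.
apply: (@le_trans _ _ (\sum_(0 <= j < I ^ 2) (I%:R ^+ 2)^-1)).
  by apply: ler_sum => j _; rewrite -[leRHS]mul1r ler_pdivlMr // mulrC; apply: beta_prod_le.
rewrite sumr_const_nat subn0 -[_ *+ _]mulr_natr natrX mulVf //; lra.
Qed.

Lemma sum_beta0_drop m N : (m <= N)%N ->
  \sum_(m <= j < N) (beta j 0 - beta j.+1 0) = beta m 0 - beta N 0.
Proof.
move=> mN; have := telescope_sumr (fun j => - beta j 0) mN.
by rewrite opprK addrC => <-; apply: eq_bigr => j _; rewrite opprK addrC.
Qed.

Lemma beta0_anti : {homo beta^~ 0%N : m n / (m <= n)%N >-> n <= m}.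
Proof.
move=> m n mn; rewrite -subr_ge0 -sum_beta0_drop //; apply: sumr_ge0 => j _.
by rewrite beta0_drop divr_ge0 ?beta_ge0 // addr_ge0 // mulr_ge0.
Qed.

(** The differences of terms of index below [maxn i l] vanish, and the later
    ones are dominated by the telescoping differences of [beta j 0]: this
    gives a gradient that vanishes at infinity without summing powers of [j]. *)
Lemma ksum_grad i l N :
  0 <= ksum i.+1 l N - ksum i l N <= 6 * beta (maxn i l) 0.
Proof.
have E : ksum i.+1 l N - ksum i l N =
    \sum_(0 <= j < N) beta j l * (beta j i - beta j i.+1).
  by rewrite /ksum -sumrB; apply: eq_bigr => j _; rewrite /kterm; ring.
have pos j : 0 <= beta j l * (beta j i - beta j i.+1).
  by apply: mulr_ge0; rewrite ?beta_ge0 // subr_ge0 beta_decr.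
apply/andP; split; first by rewrite E sumr_ge0.
set m := maxn i l.
rewrite E; apply: (@le_trans _ _ (\sum_(0 <= j < maxn m N) beta j l * (beta j i - beta j i.+1))).
  rewrite [leRHS](big_cat_nat (n := N)) ?leq_maxr //= lerDl.
  by apply: sumr_ge0.
rewrite (big_cat_nat (n := m)) ?leq_maxl //= big_nat_cond big1 ?add0r; last first.
  move=> j; rewrite andbT => /= jm.
  case: (leqP i l) => il; first by rewrite (@beta_far j l) ?mul0r //; lia.
  by rewrite (@beta_far j i) ?(@beta_far j i.+1) ?subrr ?mulr0 //; lia.
apply: (@le_trans _ _ (\sum_(m <= j < maxn m N) 6 * (beta j 0 - beta j.+1 0))).
  apply: ler_sum => j _; rewrite beta0_drop.
  have J0 : (0 : R) <= j%:R by [].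
  have -> : 6 * (beta j 0 / (2 * j%:R + 2)) = beta j 0 * (3 / (j%:R + 1)) by field; lra.
  by apply: ler_pM; rewrite ?beta_ge0 ?beta_le0 ?beta_drop_le // subr_ge0 beta_decr.
rewrite -mulr_sumr sum_beta0_drop ?leq_maxl //; apply: ler_wpM2l => //.
by rewrite gerBl beta_ge0.
Qed.

Lemma beta0_le1 j : beta j 0 <= 1.
Proof. by rewrite -beta00; apply: beta0_anti. Qed.

Lemma returns_homo : {homo returns : m n / (m <= n)%N >-> m <= n}.
Proof.
move=> m n mn; rewrite /returns [leRHS](big_cat_nat (n := m)) //= lerDl.
by apply: sumr_ge0 => j _; apply: sqr_ge0.
Qed.

Lemma returns_scale K N : returns (K * N) <= returns N + K%:R.
Proof.
case: N => [|N]; first by rewrite muln0 lerDl.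
case: K => [|K]; first by rewrite mul0n addr0 returns_homo.
rewrite /returns (big_cat_nat (n := N.+1)) ?leq_pmull //= lerD2l.
have N0 : (0 : R) <= N%:R by [].
apply: (@le_trans _ _ (\sum_(N.+1 <= j < K.+1 * N.+1) N.+1%:R^-1)).
  apply: ler_sum_nat => j /andP[Nj _].
  have j1 : N%:R + 1 <= j%:R :> R by rewrite natr1 ler_nat.
  have h := beta0_sqr_le j.
  rewrite -[leRHS]mul1r ler_pdivlMr // -natr1.
  have : 0 <= beta j 0 ^+ 2 by apply: sqr_ge0.
  nra.
rewrite sumr_const_nat -[_ *+ _]mulr_natr mulrC ler_pdivrMr // -natrM ler_nat.
exact: leq_subr.
Qed.

End OneDim.

(** * The potential kernel of the planar walk *)

Definition nbr_mean (R : realFieldType) (g : lattice -> R) (x : lattice) : R :=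
  (g (x.1 + 1, x.2) + g (x.1 - 1, x.2) + g (x.1, x.2 + 1) + g (x.1, x.2 - 1)) / 4.

Definition lnorm (x : lattice) : nat := (`|x.1| + `|x.2|)%N.

Definition walk2 (R : realFieldType) (k : nat) (x : lattice) : R :=
  walk1 R k (x.1 + x.2) * walk1 R k (x.1 - x.2).

(** The even points are those with even rotated coordinates [x.1 + x.2 = 2 i]
    and [x.1 - x.2 = 2 l]. *)
Definition even_point (i l : int) : lattice := (i + l, i - l).
Definition odd_point (i l : int) : lattice := (i + l + 1, i - l).

Lemma even_or_odd_point (x : lattice) :
  (exists i l, x = even_point i l) \/ (exists i l, x = odd_point i l).
Proof.
case: x => x y.
have h (z : int) : exists w, z = 2 * w \/ z = 2 * w + 1.
  by exists (z %/ 2)%Z; lia.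
have [w [hw|hw]] := h (x + y).
  by left; exists w, (x - w); congr (_, _); lia.
by right; exists w, (x - 1 - w); congr (_, _); lia.
Qed.

Lemma lnorm_even_point i l : lnorm (even_point i l) = (2 * maxn `|i| `|l|)%N.
Proof. by rewrite /lnorm /even_point /=; lia. Qed.

Section PotentialKernel.
Variable R : realType.
Local Notation b := (fun j => beta R j 0).

Lemma walk2_0 x : walk2 R 0 x = (x == 0)%:R.
Proof.
rewrite /walk2 /= -natrM mulnb; congr ((nat_of_bool _)%:R).
case: x => x y /=; apply/andP/eqP => [[/eqP h1 /eqP h2]|[-> ->] //].
have -> : x = 0 by lia.
by have -> : y = 0 by lia.
Qed.

(** In the rotated coordinates [x.1 + x.2] and [x.1 - x.2] each of the four
    steps changes both coordinates by 1 in absolute value, independently. *)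
Lemma walk2S k x : walk2 R k.+1 x = nbr_mean (walk2 R k) x.
Proof.
rewrite /walk2 /nbr_mean !walk1S /=.
have -> : x.1 + 1 + x.2 = x.1 + x.2 + 1 by ring.
have -> : x.1 - 1 + x.2 = x.1 + x.2 - 1 by ring.
have -> : x.1 + (x.2 + 1) = x.1 + x.2 + 1 by ring.
have -> : x.1 + (x.2 - 1) = x.1 + x.2 - 1 by ring.
have -> : x.1 + 1 - x.2 = x.1 - x.2 + 1 by ring.
have -> : x.1 - 1 - x.2 = x.1 - x.2 - 1 by ring.
have -> : x.1 - (x.2 + 1) = x.1 - x.2 - 1 by ring.
have -> : x.1 - (x.2 - 1) = x.1 - x.2 + 1 by ring.
by field.
Qed.

Lemma walk2_ev_even j i l :
  walk2 R (2 * j) (even_point i l) = beta R j `|i| * beta R j `|l|.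
Proof.
rewrite /walk2 /even_point /= /beta; congr (_ * _).
  by rewrite -(walk1_absz R _ (_ + _)); congr walk1; lia.
by rewrite -(walk1_absz R _ (_ - _)); congr walk1; lia.
Qed.

Lemma walk2_ev_odd j i l : walk2 R (2 * j).+1 (even_point i l) = 0.
Proof.
rewrite /walk2 [_ + _](_ : _ = (2 * j).+1%:Z + 1 + 2 * (i - j%:Z - 1)); last by rewrite /even_point /=; lia.
by rewrite walk1_parity mul0r.
Qed.

Definition pk_series (x : lattice) : R^nat :=
  series (fun k => walk2 R k 0 - walk2 R k x).

Definition pk (x : lattice) : R := limn (pk_series x).

Lemma pk_series_ev i l N : pk_series (even_point i l) N = ksum R `|i| `|l| (uphalf N).
Proof.
have ev0 : (0 : lattice) = even_point 0 0 by [].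
rewrite /pk_series /series /=.
elim: N => [|N IH]; first by rewrite /ksum !big_geq.
rewrite big_nat_recr //= IH.
have [M [->|->]] : exists M, (N = 2 * M \/ N = (2 * M).+1)%N.
  by exists N./2; lia.
  rewrite ev0 !walk2_ev_even /=.
  have -> : uphalf (2 * M) = M by lia.
  have -> : (2 * M)./2.+1 = M.+1 by lia.
  by rewrite /ksum big_nat_recr //= /kterm expr2.
rewrite ev0 !walk2_ev_odd subr0 addr0; congr ksum; lia.
Qed.

Lemma pk_series_ev_cvg i l : cvgn (pk_series (even_point i l)).
Proof.
apply: nondecreasing_is_cvgn.
  by move=> m n mn; rewrite !pk_series_ev; apply: ksum_homo; lia.
exists (returns R (maxn `|i| `|l| ^ 2) + 2) => _ [N _ <-].
by rewrite pk_series_ev ksum_le.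
Qed.

Lemma walk2_diag_cvg0 : walk2 R ^~ 0 @ \oo --> (0 : R).
Proof.
have ev0 : (0 : lattice) = even_point 0 0 by [].
apply/cvgrPdist_le => e e0.
near=> n.
rewrite sub0r normrN.
have [M [nE|nE]] : exists M, (n = 2 * M \/ n = (2 * M).+1)%N.
  by exists n./2; lia.
  rewrite nE ev0 walk2_ev_even /= ger0_norm ?mulr_ge0 ?beta_ge0 // -expr2.
  have h := beta0_sqr_le R M.
  have n1 : e^-1 <= n%:R.
    near: n; exact: nbhs_infty_ger.
  have n2 : e^-1 <= 2 * M%:R + 1 by rewrite (le_trans n1) // nE natrM lerDl.
  have q : 0 < 2 * M%:R + 1 :> R by rewrite (lt_le_trans _ n2) // invr_gt0.
  move: h; rewrite -ler_pdivlMr // mul1r => h; apply: le_trans h _.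
  by rewrite -[e]invrK lef_pV2 ?posrE // invr_gt0.
by rewrite nE ev0 walk2_ev_odd normr0 ltW.
Unshelve. all: by end_near.
Qed.

(** First-step decomposition of the sum over times; the boundary term [walk2 R
    N 0] tends to 0. *)
Lemma pk_seriesS x N : pk_series x N.+1 =
  nbr_mean (fun y => pk_series y N) x + walk2 R N 0 - (x == 0)%:R.
Proof.
have E y M : pk_series y M = \sum_(0 <= k < M) walk2 R k 0 - \sum_(0 <= k < M) walk2 R k y.
  by rewrite /pk_series /series /= sumrB.
rewrite /nbr_mean !E.
have -> : \sum_(0 <= k < N.+1) walk2 R k x = (x == 0)%:R +
   \sum_(0 <= k < N) nbr_mean (walk2 R k) x.
  rewrite big_nat_recl //= walk2_0; congr (_ + _); apply: eq_bigr => k _; exact: walk2S.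
rewrite /nbr_mean -mulr_suml !big_split /= big_nat_recr //=.
by field.
Qed.

Lemma nbr_mean_cvg (u : nat -> lattice -> R) (f : lattice -> R) (x : lattice) :
  (forall y, neighbours x y -> u ^~ y @ \oo --> f y) ->
  (fun n => nbr_mean (u n) x) @ \oo --> nbr_mean f x.
Proof.
move=> h; rewrite /nbr_mean; apply: cvgMl.
by apply: cvgD; [apply: cvgD; [apply: cvgD|]|]; apply: h;
  rewrite /neighbours /=; lia.
Qed.

(** At even points the partial sums are monotone and bounded. An odd point
    inherits convergence from its neighbours, which are even, through
    [pk_seriesS]. *)
Lemma pk_series_cvg x : pk_series x @ \oo --> pk x.
Proof.
have [[i [l ->]]|[i [l xE]]] := even_or_odd_point x; first exact: pk_series_ev_cvg.
suff : cvgn (pk_series x) by [].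
apply/cvg_ex; exists (nbr_mean pk x + 0 - (x == 0)%:R).
rewrite -cvg_shiftS /=.
under eq_cvg do rewrite pk_seriesS.
apply: cvgB; last exact: cvg_cst.
apply: cvgD; last exact: walk2_diag_cvg0.
apply: nbr_mean_cvg => y hy.
have [[i' [l' ->]]|[i' [l' yE]]] := even_or_odd_point y; first exact: pk_series_ev_cvg.
by move: hy; rewrite xE yE /odd_point /neighbours /=; lia.
Qed.

Lemma pk_harmonic x : nbr_mean pk x = pk x + (x == 0)%:R.
Proof.
have h : (fun N => pk_series x N.+1) @ \oo --> pk x.
  by rewrite (cvg_shiftS (pk_series x)); exact: pk_series_cvg.
have h2 : (fun N => pk_series x N.+1) @ \oo --> nbr_mean pk x + 0 - (x == 0)%:R.
  under eq_cvg do rewrite pk_seriesS.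
  apply: cvgB; last exact: cvg_cst.
  apply: cvgD; last exact: walk2_diag_cvg0.
  by apply: nbr_mean_cvg => y _; exact: pk_series_cvg.
by rewrite (cvg_unique _ h h2) //; ring.
Qed.

Lemma walk2_sym k (x y : int) : walk2 R k (y, x) = walk2 R k (x, y) /\
  walk2 R k (- x, y) = walk2 R k (x, y).
Proof.
rewrite /walk2 /=; split.
  by rewrite addrC -(walk1N _ _ (y - x)) opprB.
have -> : - x - y = - (x + y) by ring.
have -> : - x + y = - (x - y) by ring.
by rewrite !walk1N mulrC.
Qed.

Lemma pk_sym (x y : int) : pk (y, x) = pk (x, y) /\ pk (- x, y) = pk (x, y).
Proof.
rewrite /pk /pk_series; split; congr (limn (series _)); apply/funext => k.
  by rewrite (walk2_sym k x y).1.
by rewrite (walk2_sym k x y).2.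
Qed.

Lemma pk0 : pk 0 = 0.
Proof.
rewrite /pk; have -> : pk_series 0 = cst 0.
  by apply/funext => N; rewrite /pk_series /series /= big1 // => k _; rewrite subrr.
exact: lim_cst.
Qed.

Lemma neighboursP (x y : lattice) : neighbours x y ->
  [\/ y = (x.1 + 1, x.2), y = (x.1 - 1, x.2), y = (x.1, x.2 + 1) | y = (x.1, x.2 - 1)].
Proof.
case: x y => [x1 x2] [y1 y2]; rewrite /neighbours /= => h.
have : [\/ y1 = x1 + 1 /\ y2 = x2, y1 = x1 - 1 /\ y2 = x2,
  y1 = x1 /\ y2 = x2 + 1 | y1 = x1 /\ y2 = x2 - 1].
  have : (y1 = x1 + 1 /\ y2 = x2) \/ (y1 = x1 - 1 /\ y2 = x2) \/
  (y1 = x1 /\ y2 = x2 + 1) \/ (y1 = x1 /\ y2 = x2 - 1) by lia.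
  by case=> [|[|[|]]] ?; [apply: Or41|apply: Or42|apply: Or43|apply: Or44].
by case=> -[-> ->]; [apply: Or41|apply: Or42|apply: Or43|apply: Or44].
Qed.

(** The four neighbours of the origin have the same value by symmetry, and
    their mean is 1 by [pk_harmonic]. *)
Lemma pk_nbr0 x : neighbours 0 x -> pk x = 1.
Proof.
have := pk_harmonic 0; rewrite pk0 eqxx add0r /nbr_mean /= !add0r.
have [s1 _] := pk_sym 1 0; have [s3 _] := pk_sym (- 1) 0.
have [_ s2] := pk_sym 1 0.
rewrite s1 s3 s2 => h.
have h1 : pk (1, 0) = 1 by move: h; lra.
case/neighboursP => -> /=; rewrite ?add0r ?sub0r //; first by rewrite s2.
- by rewrite s1.
- by rewrite s3 s2.
Qed.

Lemma pk_ev_bounds i l (I := maxn `|i| `|l|) :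
  returns R (I ^ 2) - 1 <= pk (even_point i l) <= returns R (I ^ 2) + 2.
Proof.
apply/andP; split.
  apply: limr_ge; first exact: pk_series_ev_cvg.
  near=> N; rewrite pk_series_ev; apply: ksum_ge.
  have : (2 * I ^ 2 <= N)%N by near: N; exact: nbhs_infty_ge.
  by rewrite -/I; lia.
apply: limr_le; first exact: pk_series_ev_cvg.
by near=> N; rewrite pk_series_ev ksum_le.
Unshelve. all: by end_near.
Qed.

(** The minimum of two consecutive absolute values appears because [ksum_grad]
    bounds a step away from the axis by its endpoint nearer to the axis. *)
Lemma pk_ev_step i l m :
  (m <= maxn (minn `|i| `|(i + 1)%R|%N) `|l|)%N ->
  `|pk (even_point (i + 1) l) - pk (even_point i l)| <= 6 * b m.
Proof.
move=> hm.
have h1 := @pk_series_ev_cvg (i + 1) l; have h2 := @pk_series_ev_cvg i l.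
have h : (fun N => pk_series (even_point (i + 1) l) N - pk_series (even_point i l) N) @ \oo -->
   pk (even_point (i + 1) l) - pk (even_point i l) by apply: cvgB.
have bd N : `|pk_series (even_point (i + 1) l) N - pk_series (even_point i l) N| <= 6 * b m.
  rewrite !pk_series_ev; set n := minn `|i| `|(i + 1)%R|%N.
  have /andP[g0 g1] := ksum_grad R n `|l| (uphalf N).
  have g2 : beta R (maxn n `|l|) 0 <= b m by apply: beta0_anti.
  have [[e1 e2]|[e1 e2]] : (`|i|%N = n /\ `|(i + 1)%R|%N = n.+1) \/ (`|(i + 1)%R|%N = n /\ `|i|%N = n.+1).
  - by rewrite /n; lia.
  - rewrite e1 e2 ger0_norm //; move: g1 g2; lra.
  - rewrite e1 e2 distrC ger0_norm //; move: g1 g2; lra.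
rewrite ler_norml; apply/andP; split.
  rewrite -(cvg_lim _ h) //; apply: limr_ge; first by apply/cvg_ex; eexists; exact: h.
  by near=> N; have := bd N; rewrite ler_norml => /andP[].
rewrite -(cvg_lim _ h) //; apply: limr_le; first by apply/cvg_ex; eexists; exact: h.
by near=> N; have := bd N; rewrite ler_norml => /andP[].
Unshelve. all: by end_near.
Qed.

Lemma pk_even_swap i l : pk (even_point i l) = pk (even_point l i).
Proof.
rewrite /even_point; have [s1 s2] := pk_sym (i + l) (i - l).
have [_ s3] := pk_sym (i - l) (i + l).
by rewrite -s1 -s3 opprB (pk_sym (i + l) (l - i)).1 [l + i]addrC.
Qed.

Lemma pk_od_avg i l : pk (odd_point i l) =
  (pk (even_point (i + 1) (l + 1)) + pk (even_point i l) + pk (even_point (i + 1) l) + pk (even_point i (l + 1))) / 4.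
Proof.
have := pk_harmonic (odd_point i l).
have -> : (odd_point i l == 0) = false by apply/eqP => -[]; lia.
rewrite addr0 => <-; rewrite /nbr_mean.
have -> : ((odd_point i l).1 + 1, (odd_point i l).2) = even_point (i + 1) (l + 1).
  by rewrite /odd_point /even_point /=; congr (_, _); ring.
have -> : ((odd_point i l).1 - 1, (odd_point i l).2) = even_point i l.
  by rewrite /odd_point /even_point /=; congr (_, _); ring.
have -> : ((odd_point i l).1, (odd_point i l).2 + 1) = even_point (i + 1) l.
  by rewrite /odd_point /even_point /=; congr (_, _); ring.
have -> : ((odd_point i l).1, (odd_point i l).2 - 1) = even_point i (l + 1).
  by rewrite /odd_point /even_point /=; congr (_, _); ring.
by [].
Qed.

Fact half_lnorm_odd_point i l (m := (lnorm (odd_point i l)).-1./2) :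
  [/\ (m <= maxn (minn `|i| `|(i + 1)%R|) `|l|)%N,
      (m <= maxn (minn `|i| `|(i + 1)%R|) `|(l + 1)%R|)%N,
      (m <= maxn (minn `|l| `|(l + 1)%R|) `|i|)%N &
      (m <= maxn (minn `|l| `|(l + 1)%R|) `|(i + 1)%R|)%N].
Proof. by rewrite /m /lnorm /odd_point /=; split; lia. Qed.

(** The value at an odd point is the mean over its four neighbours, which are
    even and at most two even steps apart. *)
Lemma pk_grad_od i l y : neighbours (odd_point i l) y ->
  `|pk (odd_point i l) - pk y| <= 12 * b ((lnorm (odd_point i l)).-1./2).
Proof.
set m := _./2 => hy.
have [m1 m2 m3 m4] := half_lnorm_odd_point i l.
have := pk_ev_step m1; have := pk_ev_step m2.
have := pk_ev_step m3; have := pk_ev_step m4.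
rewrite !(pk_even_swap (l + 1)) !(pk_even_swap l) pk_od_avg.
have yE : [\/ y = even_point (i + 1) (l + 1), y = even_point i l, y = even_point (i + 1) l | y = even_point i (l + 1)].
  case: (neighboursP hy) => ->; [apply: Or41|apply: Or42|apply: Or43|apply: Or44];
  by rewrite /odd_point /even_point /=; congr (_, _); lia.
rewrite !ler_norml => /andP[a1 a2] /andP[a3 a4] /andP[a5 a6] /andP[a7 a8].
by case: yE => ->; apply/andP; split; move: a1 a2 a3 a4 a5 a6 a7 a8; lra.
Qed.

Lemma neighbours_sym (x y : lattice) : neighbours x y = neighbours y x.
Proof. by rewrite /neighbours; lia. Qed.

Lemma lnorm_nbr x y : neighbours x y -> (lnorm y <= (lnorm x).+1)%N.
Proof. by rewrite /neighbours /lnorm; lia. Qed.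

Lemma pk_grad x y : neighbours x y ->
  `|pk x - pk y| <= 12 * b ((lnorm x).-2./2).
Proof.
move=> xy.
have w m n : (m <= n)%N -> 12 * b n <= 12 * b m.
  by move=> mn; apply: ler_wpM2l => //; apply: beta0_anti.
have [[i [l xE]]|[i [l xE]]] := even_or_odd_point x; last first.
  rewrite xE; apply: le_trans (pk_grad_od _) _; first by rewrite -xE.
  by apply: w; lia.
have [[i' [l' yE]]|[i' [l' yE]]] := even_or_odd_point y.
  by move: xy; rewrite xE yE /neighbours /even_point /=; lia.
rewrite distrC yE; apply: le_trans (pk_grad_od _) _; first by rewrite -yE neighbours_sym.
apply: w; rewrite -yE; have := @lnorm_nbr y x; rewrite neighbours_sym => /(_ xy); lia.
Qed.

Lemma pk_lip x y : neighbours x y -> `|pk x - pk y| <= 12.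
Proof.
move=> /pk_grad h; apply: le_trans h _.
by rewrite -[leRHS]mulr1; apply: ler_wpM2l => //; exact: beta0_le1.
Qed.

Lemma beta0_small (e : R) : 0 < e -> exists m, forall n, (m <= n)%N -> b n <= e.
Proof.
move=> e0.
exists (Num.bound (e ^- 2)) => n mn.
have h := beta0_sqr_le R n; have p := beta0_gt0 R n.
have hn : e ^- 2 <= n%:R.
  apply: ltW; apply: (@lt_le_trans _ _ (Num.bound (e ^- 2))%:R); last by rewrite ler_nat.
  by apply: archi_boundP; rewrite invr_ge0 sqr_ge0.
have e2 : 0 < e ^+ 2 by rewrite exprn_gt0.
have : 1 <= e ^+ 2 * n%:R by rewrite mulrC -ler_pdivrMr // mul1r.
move=> h1; rewrite leNgt; apply/negP => he.
have : e ^+ 2 < b n ^+ 2 by rewrite ltr_pXn2r // nnegrE ltW.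
move=> h2.
have : e ^+ 2 * n%:R <= b n ^+ 2 * n%:R by apply: ler_wpM2r => //; exact: ltW.
have : 0 < b n ^+ 2 by rewrite exprn_gt0.
have : 0 <= b n ^+ 2 * n%:R by apply: mulr_ge0 => //; exact: sqr_ge0.
move: h h1; lra.
Qed.

Lemma pk_grad_small (e : R) : 0 < e -> exists m, forall x y,
  neighbours x y -> (m <= lnorm x)%N -> `|pk x - pk y| <= e.
Proof.
move=> e0; have [m hm] := @beta0_small (e / 12) (divr_gt0 e0 (ltr0Sn _ _)).
exists (2 * m + 2)%N => x y xy mx; apply: le_trans (pk_grad xy) _.
by rewrite mulrC -ler_pdivlMr //; apply: hm; lia.
Qed.

(** On an annulus of bounded aspect ratio around radius [N] the kernel is
    constant up to a bounded error. The explicit constant covers the passage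
    from odd to even points by [pk_lip]. *)
Lemma pk_scale (K N : nat) x : (lnorm x <= K * N)%N -> (N <= K * lnorm x)%N ->
  `|pk x - returns R (N ^ 2)| <= 20 + 4 * (K.+1 ^ 2)%:R.
Proof.
suff H i l : forall K N, (0 < N)%N -> (lnorm (even_point i l) <= K * N)%N -> (N <= K * lnorm (even_point i l))%N ->
  `|pk (even_point i l) - returns R (N ^ 2)| <= 2 + 4 * (K ^ 2)%:R.
  case: (posnP N) => [->|N0].
    rewrite muln0 leqn0 => /eqP x0 _.
    have -> : x = 0 by move: x0; rewrite /lnorm; case: x => x y /= h; congr (_, _); lia.
    rewrite pk0 /returns big_geq // subrr normr0; apply: addr_ge0 => //; exact: mulr_ge0.
  move=> h1 h2.
  have k1 : (K ^ 2 <= K.+1 ^ 2)%N by rewrite leq_exp2r.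
  have [[i [l xE]]|[i [l xE]]] := even_or_odd_point x.
    rewrite xE in h1 h2 *; apply: le_trans (H _ _ _ _ N0 h1 h2) _.
    have : (K ^ 2)%:R <= (K.+1 ^ 2)%:R :> R by rewrite ler_nat.
    lra.
  pose y := if (maxn `|(i + 1)%R| `|(l + 1)%R| <= maxn `|i| `|l|)%N then even_point i l else even_point (i + 1) (l + 1).
  have xy : neighbours x y.
    by rewrite /y; case: ifP => _; rewrite xE /neighbours /odd_point /even_point /=; lia.
  have yn : (lnorm x <= lnorm y)%N.
    by rewrite /y; case: ifP => h; rewrite xE /lnorm /odd_point /even_point /=; lia.
  have yn' := lnorm_nbr xy.
  have [i' [l' yE]] : exists i' l', y = even_point i' l'.
    by rewrite /y; case: ifP => _; [exists i, l|exists (i + 1), (l + 1)].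
  have H1 : (lnorm (even_point i' l') <= K.+1 * N)%N by rewrite -yE; nia.
  have H2 : (N <= K.+1 * lnorm (even_point i' l'))%N by rewrite -yE; nia.
  have := H _ _ _ _ N0 H1 H2; have := pk_lip xy; rewrite -yE.
  rewrite !ler_norml => /andP[a1 a2] /andP[a3 a4]; apply/andP; split; lra.
move=> {x K N} K N N0; rewrite lnorm_even_point; set I := maxn _ _ => h1 h2.
have /andP[b1 b2] := pk_ev_bounds i l; rewrite -/I in b1 b2.
have c1 : returns R (I ^ 2) <= returns R (N ^ 2) + (K ^ 2)%:R.
  apply: le_trans (returns_scale _ _ _); rewrite -expnMn; apply: returns_homo.
  by rewrite leq_exp2r //; lia.
have c2 : returns R (N ^ 2) <= returns R (I ^ 2) + ((2 * K) ^ 2)%:R.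
  apply: le_trans (returns_scale _ _ _); rewrite -expnMn; apply: returns_homo.
  by rewrite leq_exp2r //; lia.
have c3 : ((2 * K) ^ 2)%:R = 4 * (K ^ 2)%:R :> R by rewrite expnMn natrM.
have c4 : 0 <= (K ^ 2)%:R :> R by [].
rewrite ler_norml; apply/andP; split; lra.
Qed.

Lemma returns_unbounded (B : R) : exists N, forall n, (N <= n)%N -> B <= returns R n.
Proof.
suff [N hN] : exists N, B <= returns R N.
  by exists N => n Nn; apply: le_trans hN _; apply: returns_homo.
apply: contrapT => hB.
apply: (@dvg_harmonic R).
have bd n : returns R n <= B.
  by rewrite leNgt; apply/negP => h; apply: hB; exists n; apply: ltW.
apply: nondecreasing_is_cvgn.
  apply/nondecreasing_seqP => n; rewrite /series /= big_nat_recr //= lerDl.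
  by rewrite /harmonic /=.
exists (4 * B) => _ [n _ <-].
apply: (@le_trans _ _ (4 * returns R n.+1)); last by apply: ler_wpM2l.
rewrite /series /returns /= big_nat_recl //= mulrDr mulr_sumr.
apply: (@le_trans _ _ (\sum_(0 <= i < n) 4 * b i.+1 ^+ 2)).
  apply: ler_sum => i _; rewrite /harmonic /=.
  have := beta0_sqr_ge R i; rewrite mulrAC => h.
  by rewrite -[leLHS]mul1r ler_pdivrMr.
rewrite lerDr; apply: mulr_ge0 => //; exact: sqr_ge0.
Qed.

(** This is the recurrence of the planar walk in the form used by the minimum
    principle. *)
Lemma pk_unbounded (B : R) : exists m, forall x, (m <= lnorm x)%N -> B <= pk x.
Proof.
have [N hN] := returns_unbounded (B + (20 + 4 * (2 ^ 2)%:R)).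
exists N => x Nx.
have := @pk_scale 1 (lnorm x) x; rewrite !mul1n => /(_ (leqnn _) (leqnn _)).
rewrite ler_norml => /andP[h _].
have : B + (20 + 4 * (2 ^ 2)%:R) <= returns R (lnorm x ^ 2).
  by apply: hN; apply: leq_trans Nx _; case: (lnorm x) => // n; rewrite -mulnn leq_pmulr.
move: h; lra.
Qed.

Lemma pk_ev_ge1 i l : even_point i l != 0 -> 1 <= pk (even_point i l).
Proof.
move=> x0.
have il : (maxn `|i| `|l| != 0)%N.
  apply: contraNneq x0 => h; apply/eqP; rewrite /even_point; congr (_, _); lia.
apply: limr_ge; first exact: pk_series_ev_cvg.
near=> N.
have N1 : (1 <= uphalf N)%N.
  have : (1 <= N)%N by near: N; exact: nbhs_infty_ge.
  by lia.
rewrite pk_series_ev; apply: le_trans (ksum_homo R _ _ N1).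
rewrite /ksum big_nat1 /kterm beta00 expr1n.
have [i0|l0] : (0 < `|i|)%N \/ (0 < `|l|)%N by lia.
  by rewrite (beta_far _ i0) mul0r subr0.
by rewrite (beta_far _ l0) mulr0 subr0.
Unshelve. all: by end_near.
Qed.

Lemma pk_gt0 x : x != 0 -> 0 < pk x.
Proof.
have ge0 i l : 0 <= pk (even_point i l).
  have [->|h] := eqVneq (even_point i l) 0; first by rewrite pk0.
  by apply: le_trans (pk_ev_ge1 h).
have [[i [l ->]]|[i [l ->]]] := even_or_odd_point x => x0.
  by apply: lt_le_trans (pk_ev_ge1 x0).
rewrite pk_od_avg.
have g1 := ge0 i l; have g2 := ge0 (i + 1) l; have g3 := ge0 i (l + 1).
have g4 := ge0 (i + 1) (l + 1).
have [h|h] := eqVneq (even_point i l) 0; last by have := pk_ev_ge1 h; lra.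
have h' : even_point (i + 1) l != 0.
  by apply/eqP => h1; move: h h1; rewrite /even_point => -[h2 h3] [h4 h5]; lia.
by have := pk_ev_ge1 h'; lra.
Qed.

Lemma pk_ge0 x : 0 <= pk x.
Proof. by have [->|/pk_gt0/ltW //] := eqVneq x 0; rewrite pk0. Qed.

End PotentialKernel.

(** * A minimum principle *)

Section MinimumPrinciple.
Variable R : realType.
Implicit Types (f g w : lattice -> R).

Lemma seq_argmin (T : eqType) (f : T -> R) (s : seq T) (x : T) :
  x \in s -> exists2 y, y \in s & forall z, z \in s -> f y <= f z.
Proof.
elim: s x => // a s IH x _.
case: s IH => [_|b s IH].
  by exists a; rewrite ?mem_head // => z; rewrite inE => /eqP ->.
have [y ys hy] := IH b (mem_head _ _).
have [h|h] := leP (f a) (f y).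
  exists a; first exact: mem_head.
  move=> z; rewrite inE => /orP[/eqP -> //|zs].
  exact: le_trans h (hy _ zs).
exists y; first by rewrite inE ys orbT.
by move=> z; rewrite inE => /orP[/eqP ->|/hy //]; exact: ltW.
Qed.

Definition box (M : nat) : seq lattice :=
  [seq (i%:Z - M%:Z, j%:Z - M%:Z) | i <- iota 0 (2 * M).+1, j <- iota 0 (2 * M).+1].

Lemma mem_box M x : (lnorm x <= M)%N -> x \in box M.
Proof.
case: x => x y; rewrite /lnorm /= => h.
apply/allpairsP; exists (absz (x + M%:Z)%R, absz (y + M%:Z)%R).
by split; rewrite ?mem_iota; [move=> /=; lia | move=> /=; lia | congr (_, _) => /=; lia].
Qed.

(** Among the finitely many points where the negative minimum is reached, take
    one with the largest first coordinate: its right neighbour would also be a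
    minimum. *)
Lemma min_principle g M :
  (forall x, g x < 0 -> (lnorm x <= M)%N /\ nbr_mean g x <= g x) ->
  forall x, 0 <= g x.
Proof.
move=> hg x; rewrite leNgt; apply/negP => gx.
have [xm xms hm] := seq_argmin g (mem_box (hg _ gx).1).
have gm y : g xm <= g y.
  have [h|h] := ltP (g y) 0; first by apply/hm/mem_box; case: (hg _ h).
  by apply: le_trans h; apply: le_trans (ltW gx); apply: hm; apply: mem_box; case: (hg _ gx).
have gm0 : g xm < 0 := le_lt_trans (gm x) gx.
(* among the minima, [y] below has the largest first coordinate *)
pose s := [seq y <- box M | g y == g xm].
have ins y : g y = g xm -> y \in s.
  move=> e; rewrite mem_filter e eqxx mem_box //.
  by case: (hg y); rewrite // e.
have [y ys hy] := seq_argmin (fun y => - (y.1)%:~R : R) (ins xm erefl).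
have gy : g y = g xm by move: ys; rewrite mem_filter => /andP[/eqP].
have := hg y; rewrite gy => /(_ gm0) [_]; rewrite /nbr_mean => hn.
have e1 : g (y.1 + 1, y.2) = g xm.
  apply/eqP; rewrite eq_le gm andbT.
  have := gm (y.1 - 1, y.2); have := gm (y.1, y.2 + 1); have := gm (y.1, y.2 - 1).
  move: hn; lra.
have := hy _ (ins _ e1); rewrite /= lerN2 ler_int; lia.
Qed.

(** Adding [e * a], which is harmonic off the origin and unbounded, to a
    function that is bounded below makes its negative set finite; then let [e]
    tend to 0. *)
Lemma superharmonic_ge0 w B :
  (forall x, - B <= w x) ->
  (forall x, w x < 0 -> x != 0 /\ nbr_mean w x <= w x) ->
  forall x, 0 <= w x.
Proof.
move=> hB hw x.
have H e : 0 < e -> 0 <= e * pk R x + w x.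
  move=> e0.
  have [M hM] := pk_unbounded (B / e).
  pose f y := e * pk R y + w y.
  apply: (@min_principle f M) => y fy.
  have wy : w y < 0.
    by move: fy; rewrite /f; have := mulr_ge0 (ltW e0) (pk_ge0 R y); lra.
  have [y0 hy] := hw _ wy; split.
    rewrite leqNgt; apply/negP => /ltnW /hM h.
    move: h fy; rewrite ler_pdivrMr // /f mulrC; have := hB y; lra.
  have := pk_harmonic R y; rewrite (negPf y0) addr0 => hp.
  have -> : nbr_mean f y = e * nbr_mean (pk R) y + nbr_mean w y by rewrite /nbr_mean /f; ring.
  by rewrite hp /f; lra.
have p0 := pk_ge0 R x.
rewrite leNgt; apply/negP => wx.
have e0 : 0 < - w x / (pk R x + 1) / 2 by rewrite !divr_gt0 //; lra.
have := H _ e0.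
have : - w x / (pk R x + 1) / 2 * pk R x <= - w x / 2.
  rewrite mulrAC; apply: ler_wpM2r; first by lra.
  by rewrite mulrAC ler_pdivrMr; [nra|lra].
lra.
Qed.

End MinimumPrinciple.

(** * The Green function of the walk killed at the origin *)

Section Green.
Variable R : realType.
Local Notation a := (pk R).

Lemma pk_lip_path x z : `|a x - a z| <= 12 * (lnorm (x - z))%:R.
Proof.
move: {2}(lnorm (x - z)) (erefl (lnorm (x - z))) => n.
elim: n z => [|n IH] z hn.
  have -> : x = z.
    by move: hn; case: x z => x1 x2 [z1 z2]; rewrite /lnorm /= => h; congr (_, _); lia.
  by rewrite subrr normr0 mulr_ge0.
have [z' [zz' hz']] : exists z', neighbours z z' /\ lnorm (x - z') = n.
  case: x z hn {IH} => x1 x2 [z1 z2]; rewrite /neighbours /lnorm /= => hn.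
  have [h|[h|[h|h]]] : x1 > z1 \/ x1 < z1 \/ x2 > z2 \/ x2 < z2 by lia.
  - by exists (z1 + 1, z2) => /=; lia.
  - by exists (z1 - 1, z2) => /=; lia.
  - by exists (z1, z2 + 1) => /=; lia.
  - by exists (z1, z2 - 1) => /=; lia.
have := IH _ hz'; have := pk_lip R zz'; rewrite hn hz' -[n.+1%:R]natr1.
rewrite !ler_norml => /andP[a1 a2] /andP[a3 a4]; apply/andP; split; lra.
Qed.

Definition green (y x : lattice) : R := a x + a y - a (x - y).

Lemma pkN x : a (- x) = a x.
Proof.
case: x => x1 x2; have [_ h1] := pk_sym R x1 (- x2).
have [h2 _] := pk_sym R (- x2) x1; have [_ h3] := pk_sym R x2 x1.
have [h4 _] := pk_sym R x1 x2.
by rewrite -[- (x1, x2)]/(- x1, - x2) h1 h2 h3 h4.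
Qed.

(** Both unit masses of the Laplacian of [a] appear, one at the origin from [a
    x] and one at [y] from [a (x - y)]. *)
Lemma nbr_mean_green y x : nbr_mean (green y) x = green y x + (x == 0)%:R - (x == y)%:R.
Proof.
have -> : nbr_mean (green y) x = nbr_mean a x + a y - nbr_mean a (x - y).
  rewrite /nbr_mean /green /=.
  have e (i j : int) : (x.1 + i, x.2 + j) - y = ((x - y).1 + i, (x - y).2 + j).
    by case: (x) (y) => x1 x2 [y1 y2]; congr (_, _) => /=; ring.
  have e1 := e 1 0; have e2 := e (- 1) 0; have e3 := e 0 1; have e4 := e 0 (- 1).
  rewrite !addr0 in e1 e2 e3 e4.
  by rewrite e1 e2 e3 e4; field.
by rewrite !pk_harmonic /green subr_eq0; ring.
Qed.

Lemma green0 y : green y 0 = 0.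
Proof. by rewrite /green pk0 sub0r pkN; ring. Qed.

Lemma green_diag y : green y y = 2 * a y.
Proof. by rewrite /green subrr pk0; ring. Qed.

(** The kernel is Lipschitz, so [a x - a (x - y)] is bounded by a multiple of
    the size of [y]. *)
Lemma green_bounded y : exists B, forall x, `|green y x| <= B.
Proof.
exists (a y + 12 * (lnorm y)%:R) => x.
have e : x - (x - y) = y by rewrite opprB addrC subrK.
have := pk_lip_path x (x - y); rewrite e /green => h.
have := pk_ge0 R y; move: h; rewrite !ler_norml => /andP[h1 h2] h3.
apply/andP; split; lra.
Qed.

Lemma green_ge0 y x : 0 <= green y x.
Proof.
have [B hB] := green_bounded y.
apply: (@superharmonic_ge0 _ _ B) => z.
  by have := hB z; rewrite ler_norml => /andP[].
move=> h; have z0 : z != 0 by apply/eqP => z0; rewrite z0 green0 ltxx in h.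
by split=> //; rewrite nbr_mean_green (negPf z0) addr0 gerBl.
Qed.

End Green.

(** * Avoiding a finite set *)

Section Avoidance.
Variable R : realType.
Local Notation a := (pk R).
Variable Y : seq lattice.

(** [avoid_pot n x / a x] is the probability that the conditioned walk started
    at [x] avoids [Y] up to time [n]. Multiplying by [a] turns the transition
    matrix into the plain mean over neighbours, with the origin as an
    additional killed point. *)
Fixpoint avoid_pot (n : nat) (x : lattice) : R :=
  if (x \in Y) || (x == 0) then 0
  else if n is n'.+1 then nbr_mean (avoid_pot n') x else a x.

Lemma avoid_pot_kill n x : (x \in Y) || (x == 0) -> avoid_pot n x = 0.
Proof. by case: n => [|n] /= ->. Qed.

Lemma avoid_potS n x : ~~ ((x \in Y) || (x == 0)) ->
  avoid_pot n.+1 x = nbr_mean (avoid_pot n) x.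
Proof. by move=> /= /negPf ->. Qed.

Lemma ler_nbr_mean (f g : lattice -> R) x : (forall y, f y <= g y) -> nbr_mean f x <= nbr_mean g x.
Proof.
move=> h; rewrite /nbr_mean; apply: ler_wpM2r => //.
by rewrite !lerD.
Qed.

Lemma avoid_pot_ge0 n x : 0 <= avoid_pot n x.
Proof.
elim: n x => [|n IH] x /=; case: ifP => // _; first exact: pk_ge0.
have : nbr_mean (fun=> 0) x <= nbr_mean (avoid_pot n) x by apply: ler_nbr_mean.
by rewrite /nbr_mean !addr0 mul0r.
Qed.

Lemma avoid_pot_decr n x : avoid_pot n.+1 x <= avoid_pot n x.
Proof.
elim: n x => [|n IH] x.
  have [h|h] := boolP ((x \in Y) || (x == 0)); first by rewrite !avoid_pot_kill.
  rewrite avoid_potS //= (negPf h).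
  have -> : a x = nbr_mean a x.
    by rewrite pk_harmonic; move: h; rewrite negb_or => /andP[_ /negPf ->]; rewrite addr0.
  by apply: ler_nbr_mean => y /=; case: ifP => _ //; exact: pk_ge0.
have [h|h] := boolP ((x \in Y) || (x == 0)); first by rewrite !avoid_pot_kill.
by rewrite !avoid_potS //; apply: ler_nbr_mean.
Qed.

Definition avoid_lim (x : lattice) : R := limn (avoid_pot ^~ x).

Lemma avoid_pot_cvg x : avoid_pot ^~ x @ \oo --> avoid_lim x.
Proof.
apply: nonincreasing_is_cvgn.
  by apply/nonincreasing_seqP => n; exact: avoid_pot_decr.
by exists 0 => _ [n _ <-]; exact: avoid_pot_ge0.
Qed.

Lemma avoid_lim_kill x : (x \in Y) || (x == 0) -> avoid_lim x = 0.
Proof.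
move=> h; rewrite /avoid_lim; have -> : avoid_pot ^~ x = cst 0.
  by apply/funext => n; rewrite avoid_pot_kill.
exact: lim_cst.
Qed.

Lemma avoid_lim_harmonic x : ~~ ((x \in Y) || (x == 0)) ->
  nbr_mean avoid_lim x = avoid_lim x.
Proof.
move=> h.
have h1 : (fun n => avoid_pot n.+1 x) @ \oo --> avoid_lim x.
  by rewrite (cvg_shiftS (avoid_pot ^~ x)); exact: avoid_pot_cvg.
have h2 : (fun n => avoid_pot n.+1 x) @ \oo --> nbr_mean avoid_lim x.
  under eq_cvg do rewrite avoid_potS //.
  by apply: nbr_mean_cvg => y _; exact: avoid_pot_cvg.
by rewrite (cvg_unique _ h1 h2).
Qed.

Lemma avoid_lim_le x : avoid_lim x <= a x.
Proof.
apply: limr_le; first by apply: avoid_pot_cvg.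
apply: nearW; elim=> [|n IH]; last exact: le_trans (avoid_pot_decr _ _) IH.
by rewrite /=; case: ifP => // _; exact: pk_ge0.
Qed.

Definition green_sum (x : lattice) : R := \sum_(y <- Y) green R y x.

Lemma green_sum_harmonic x : ~~ ((x \in Y) || (x == 0)) ->
  nbr_mean green_sum x = green_sum x.
Proof.
rewrite negb_or => /andP[xY /negPf x0].
rewrite /nbr_mean /green_sum -!big_split /= mulr_suml.
apply: eq_big_seq => y yY.
have := nbr_mean_green R y x; rewrite /nbr_mean x0 => ->.
have -> : (x == y) = false by apply/eqP => e; rewrite e yY in xY.
by rewrite addr0 subr0.
Qed.

Lemma green_sum0 : green_sum 0 = 0.
Proof. by rewrite /green_sum big1 // => y _; exact: green0. Qed.

Lemma green_sum_ge0 x : 0 <= green_sum x.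
Proof. by apply: sumr_ge0 => y _; exact: green_ge0. Qed.

(** The comparison function is harmonic off [Y] and the origin and nonpositive
    on them, so every iterate [avoid_pot n] stays above it. *)
Lemma avoid_lim_ge (c : R) x : 0 <= c ->
  (forall y, y \in Y -> a y <= c * green_sum y) ->
  a x - c * green_sum x <= avoid_lim x.
Proof.
move=> c0 hc; apply: limr_ge; first exact: avoid_pot_cvg.
apply: nearW => n'.
have hk z : (z \in Y) || (z == 0) -> a z - c * green_sum z <= 0.
  case/orP => [/hc|/eqP ->]; first by rewrite subr_le0.
  by rewrite pk0 green_sum0 mulr0 subrr.
have [h|h] := boolP ((x \in Y) || (x == 0)).
  by rewrite avoid_pot_kill // hk.
elim: n' x h => [|m IH] {}x h.
  by rewrite /= (negPf h) gerBl mulr_ge0 // green_sum_ge0.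
rewrite avoid_potS //.
have -> : a x - c * green_sum x = nbr_mean (fun z => a z - c * green_sum z) x.
  rewrite -(green_sum_harmonic h).
  have := pk_harmonic R x.
  have -> : (x == 0) = false by move: h; rewrite negb_or => /andP[_ /negPf].
  by rewrite addr0 => <-; rewrite /nbr_mean; field.
apply: ler_nbr_mean => z.
have [h'|h'] := boolP ((z \in Y) || (z == 0)); last exact: IH.
by rewrite avoid_pot_kill // hk.
Qed.

(** The difference is bounded below because [avoid_lim] is at most [a] and the
    Green functions are bounded; it is harmonic off [Y] and the origin, so
    [superharmonic_ge0] applies. *)
Lemma avoid_lim_le_green (c : R) x : 0 <= c ->
  (forall y, y \in Y -> c * green_sum y <= a y) ->
  avoid_lim x <= a x - c * green_sum x.
Proof.
move=> c0 hc.
have [B hB] : exists B, forall z, green_sum z <= B.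
  rewrite /green_sum; elim: (Y) => [|y Y' [B IH]].
    by exists 0 => z; rewrite big_nil.
  have [B' hB'] := green_bounded R y.
  exists (B' + B) => z; rewrite big_cons lerD //.
  by apply: le_trans (hB' z); exact: ler_norm.
pose w z := a z - c * green_sum z - avoid_lim z.
suff : 0 <= w x by rewrite /w subr_ge0.
apply: (@superharmonic_ge0 _ w (c * B)) => z.
  rewrite /w; have h1 := avoid_lim_le z.
  have : c * green_sum z <= c * B by apply: ler_wpM2l.
  lra.
move=> wz.
have h : ~~ ((z \in Y) || (z == 0)).
  apply/negP => h; move: wz; rewrite /w avoid_lim_kill // subr0.
  case/orP: h => [/hc h|/eqP ->]; first by rewrite subr_lt0 ltNge h.
  by rewrite pk0 green_sum0 mulr0 subrr ltxx.
have z0 : z != 0 by move: h; rewrite negb_or => /andP[].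
split=> //.
have e1 := pk_harmonic R z; rewrite (negPf z0) addr0 in e1.
have e2 := green_sum_harmonic h; have e3 := avoid_lim_harmonic h.
suff -> : nbr_mean w z = nbr_mean a z - c * nbr_mean green_sum z - nbr_mean avoid_lim z.
  by rewrite e1 e2 e3.
by rewrite /nbr_mean /w; field.
Qed.

End Avoidance.

(** * Avoiding points that are far apart *)

Section Asymptotics.
Variable R : realType.
Local Notation a := (pk R).

(** The matrix of the values [green y y'] is close to [L] times the matrix
    with entries 2 on the diagonal and 1 elsewhere, whose column sums are
    computed here. *)
Lemma sum_uniq_diag (Y : seq lattice) y' : uniq Y -> y' \in Y ->
  \sum_(y <- Y) (1 + (y == y')%:R) = (size Y).+1%:R :> R.
Proof.
move=> uY yY; rewrite big_split /= big_const_seq iter_addr_0 count_predT.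
rewrite -natr_sum -natr1; congr (_ + _).
have -> : (\sum_(y <- Y) (y == y') = 1)%N; last by [].
rewrite -[LHS]/(\sum_(y <- Y) nat_of_bool (y == y'))%N -big_mkcond /= sum1_count.
by rewrite (count_uniq_mem y' uY) yY.
Qed.

(** For points separated at scale [N], the column sums of the Green matrix are
    close to [(k + 1) L] while [a] is close to [L], so the two comparison
    constants are close to [1 / (k + 1)]. *)
Lemma avoid_asymp (k K : nat) (e : R) : 0 < e -> exists N0, forall N Y x0,
  (N0 <= N)%N -> uniq Y -> size Y = k ->
  (forall y, y \in Y -> (lnorm y <= K * N)%N /\ (N <= K * lnorm y)%N) ->
  (forall y y', y \in Y -> y' \in Y -> y != y' -> (N <= K * lnorm (y - y')%R)%N) ->
  neighbours 0 x0 ->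
  `|avoid_lim R Y x0 - k.+1%:R^-1| <= e.
Proof.
move=> e0.
(* 11 is the constant of the first-order error in [lo2] below *)
pose h := Num.min (e / 11) (1 / 10).
have h0 : 0 < h by rewrite lt_min !divr_gt0.
have he : 11 * h <= e by rewrite mulrC -ler_pdivlMr // ge_min lexx.
have h1 : h <= 1 / 10 by rewrite ge_min lexx orbT.
pose C : R := 20 + 4 * ((2 * K).+1 ^ 2)%:R.
have [N1 hN1] := returns_unbounded (C / h).
have [m hm] := pk_grad_small h0.
exists (maxn N1 (K * m)).+1 => N Y x0 hN uY sY hY hYY hx0.
set L := returns R (N ^ 2).
have CL : C <= h * L.
  rewrite mulrC -ler_pdivrMr //; apply: hN1; rewrite -mulnn.
  by apply: (@leq_trans N); [lia | apply: leq_pmulr; lia].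
have L0 : 0 <= L by apply: sumr_ge0 => j _; exact: sqr_ge0.
have hL0 : 0 <= h * L by apply: mulr_ge0 => //; exact: ltW.
have scale x : (lnorm x <= 2 * K * N)%N -> (N <= 2 * K * lnorm x)%N ->
    `|a x - L| <= h * L.
  by move=> l1 l2; apply: le_trans (pk_scale R l1 l2) CL.
clearbody L.
have aL y : y \in Y -> `|a y - L| <= h * L.
  move=> /hY [l1 l2]; apply: scale; rewrite -mulnA mul2n -addnn.
    by rewrite (leq_trans l1) ?leq_addr.
  by rewrite (leq_trans l2) ?leq_addr.
have gL y y' : y \in Y -> y' \in Y ->
    (1 - 3 * h) * L * (1 + (y == y')%:R) <= green R y y' <= (1 + 3 * h) * L * (1 + (y == y')%:R).
  move=> yY yY'; have := aL _ yY; have := aL _ yY'.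
  rewrite !ler_norml => /andP[b1 b2] /andP[b3 b4].
  have [->|ny] := eqVneq y y'; first by rewrite /= green_diag; apply/andP; split; lra.
  have : `|a (y' - y) - L| <= h * L.
    have [l1 _] := hY _ yY; have [l2 _] := hY _ yY'.
    have l3 : (N <= K * lnorm (y' - y)%R)%N by apply: hYY => //; rewrite eq_sym.
    have l4 : (lnorm (y' - y)%R <= lnorm y' + lnorm y)%N.
      by rewrite /lnorm /=; clear; lia.
    apply: scale; last by rewrite -mulnA mul2n -addnn (leq_trans l3) ?leq_addr.
    by rewrite -mulnA mul2n -addnn (leq_trans l4) // leq_add.
  rewrite ler_norml => /andP[b5 b6]; rewrite /green addr0 mulr1.
  by apply/andP; split; lra.
have gS y' : y' \in Y ->
    (1 - 3 * h) * L * k.+1%:R <= green_sum R Y y' <= (1 + 3 * h) * L * k.+1%:R.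
  move=> yY; rewrite -sY -(sum_uniq_diag uY yY) /green_sum !mulr_sumr; apply/andP; split.
    by rewrite big_seq [leRHS]big_seq; apply: ler_sum => y yY'; case/andP: (gL _ _ yY' yY).
  by rewrite big_seq [leRHS]big_seq; apply: ler_sum => y yY'; case/andP: (gL _ _ yY' yY).
have gx : `|green_sum R Y x0 - k%:R| <= h * k%:R.
  have -> : green_sum R Y x0 - k%:R = \sum_(y <- Y) (green R y x0 - 1).
    by rewrite sumrB big_const_seq iter_addr_0 count_predT sY.
  apply: (le_trans (ler_norm_sum _ _ _)).
  have -> : h * k%:R = \sum_(y <- Y) h.
    by rewrite big_const_seq iter_addr_0 count_predT sY mulr_natr.
  rewrite big_seq [leRHS]big_seq; apply: ler_sum => y yY.
  have -> : green R y x0 - 1 = a (- y) - a (x0 - y).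
    by rewrite /green (pk_nbr0 R hx0) pkN; ring.
  apply: hm; first by move: hx0; rewrite /neighbours; case: (y) x0 => y1 y2 [z1 z2] /=; lia.
  have [_ l2] := hY _ yY.
  have -> : lnorm (- y) = lnorm y by rewrite /lnorm /=; clear; lia.
  have l3 : (K * m < K * lnorm y)%N by apply: leq_trans l2; apply: leq_trans hN; rewrite ltnS leq_maxr.
  by apply: ltnW; move: l3; rewrite ltn_mul2l => /andP[].
have K0 : 0 < k.+1%:R :> R by rewrite ltr0Sn.
have K1 : k%:R = k.+1%:R - 1 :> R by rewrite -natr1 addrK.
set q := k.+1%:R in K0 K1 gS *.
have c0 : 0 <= (1 - h) / (q * (1 + 3 * h)) by apply: divr_ge0; [lra|apply: mulr_ge0; lra].
have d0 : 0 <= (1 + h) / (q * (1 - 3 * h)) by apply: divr_ge0; [lra|apply: mulr_ge0; lra].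
have up := @avoid_lim_le_green R Y _ x0 c0.
have lo := @avoid_lim_ge R Y _ x0 d0.
have {}up : avoid_lim R Y x0 <= 1 - (1 - h) / (q * (1 + 3 * h)) * green_sum R Y x0.
  apply: le_trans (up _) _; last by rewrite (pk_nbr0 R hx0).
  move=> y yY.
  have := aL _ yY; rewrite ler_norml => /andP[b1 _].
  have /andP[_ b2] := gS _ yY.
  apply: (@le_trans _ _ ((1 - h) / (q * (1 + 3 * h)) * ((1 + 3 * h) * L * q))).
    exact: ler_wpM2l.
  have -> : (1 - h) / (q * (1 + 3 * h)) * ((1 + 3 * h) * L * q) = (1 - h) * L.
    by field; apply/andP; split; lra.
  lra.
have {}lo : 1 - (1 + h) / (q * (1 - 3 * h)) * green_sum R Y x0 <= avoid_lim R Y x0.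
  apply: le_trans (lo _); first by rewrite (pk_nbr0 R hx0).
  move=> y yY.
  have := aL _ yY; rewrite ler_norml => /andP[_ b1].
  have /andP[b2 _] := gS _ yY.
  apply: (@le_trans _ _ ((1 + h) / (q * (1 - 3 * h)) * ((1 - 3 * h) * L * q))); last first.
    exact: ler_wpM2l.
  have -> : (1 + h) / (q * (1 - 3 * h)) * ((1 - 3 * h) * L * q) = (1 + h) * L.
    by field; apply/andP; split; lra.
  lra.
have p0 : 0 <= k%:R / q <= 1.
  have k0 : (0 : R) <= k%:R by [].
  by rewrite divr_ge0 ?(ltW K0) //= ler_pdivrMr // mul1r K1; lra.
case/andP: p0 => p0 p1.
have k0 : (0 : R) <= k%:R by [].
move: gx; rewrite ler_norml => /andP[g1 g2].
have qE : q^-1 = 1 - k%:R / q by rewrite K1; field; lra.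
have up2 : (1 - 5 * h) * (k%:R / q) <= (1 - h) / (q * (1 + 3 * h)) * green_sum R Y x0.
  have -> : (1 - h) / (q * (1 + 3 * h)) * green_sum R Y x0 =
     ((1 - h) / (1 + 3 * h)) * (green_sum R Y x0 / q) by field; apply/andP; split; lra.
  have s1 : (1 - h) * (k%:R / q) <= green_sum R Y x0 / q.
    by rewrite mulrA; apply: ler_wpM2r; rewrite ?invr_ge0 ?(ltW K0) //; lra.
  have s2 : (1 - 5 * h) <= (1 - h) / (1 + 3 * h) * (1 - h).
    rewrite mulrAC ler_pdivlMr; last by lra.
    by have := sqr_ge0 h; lra.
  apply: (@le_trans _ _ ((1 - h) / (1 + 3 * h) * (1 - h) * (k%:R / q))).
    exact: ler_wpM2r.
  rewrite -[leLHS]mulrA; apply: ler_wpM2l s1; apply: divr_ge0; lra.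
have lo2 : (1 + h) / (q * (1 - 3 * h)) * green_sum R Y x0 <= (1 + 11 * h) * (k%:R / q).
  have -> : (1 + h) / (q * (1 - 3 * h)) * green_sum R Y x0 =
     ((1 + h) / (1 - 3 * h)) * (green_sum R Y x0 / q) by field; apply/andP; split; lra.
  have s1 : green_sum R Y x0 / q <= (1 + h) * (k%:R / q).
    by rewrite mulrA; apply: ler_wpM2r; rewrite ?invr_ge0 ?(ltW K0) //; lra.
  have s2 : (1 + h) / (1 - 3 * h) * (1 + h) <= 1 + 11 * h.
    rewrite mulrAC ler_pdivrMr; last by lra.
    have : h * h <= h * (1 / 10) by apply: ler_wpM2l => //; exact: ltW.
    lra.
  apply: (@le_trans _ _ ((1 + h) / (1 - 3 * h) * (1 + h) * (k%:R / q))); last first.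
    exact: ler_wpM2r.
  rewrite -[leRHS]mulrA; apply: ler_wpM2l s1; apply: divr_ge0; lra.
have t1 : h * (k%:R / q) <= h * 1 by apply: ler_wpM2l => //; exact: ltW.
rewrite ler_norml qE.
move: t1 up lo up2 lo2 p0.
set r := k%:R / q; set S1 := _ / _ * green_sum R Y x0; set S2 := _ / _ * green_sum R Y x0.
clearbody r S1 S2; move: (avoid_lim R Y x0) => u t1 up lo up2 lo2 p0.
apply/andP; split; lra.
Qed.

End Asymptotics.

(** * Nearest-neighbour Markov chains on the lattice *)

Definition nbrs (x : lattice) : seq lattice :=
  [:: (x.1 + 1, x.2); (x.1 - 1, x.2); (x.1, x.2 + 1); (x.1, x.2 - 1)].

Lemma uniq_nbrs x : uniq (nbrs x).
Proof.
case: x => x y; rewrite /nbrs /= !inE !xpair_eqE.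
by rewrite !negb_or !negb_and; lia.
Qed.

Lemma mem_nbrs x y : (y \in nbrs x) = neighbours x y.
Proof.
apply/idP/idP => [|/neighboursP]; rewrite !inE.
  by case/or4P => /eqP ->; rewrite /neighbours /=; lia.
by case=> ->; rewrite eqxx ?orbT.
Qed.

Lemma nbr_meanE (R : realFieldType) (g : lattice -> R) x :
  nbr_mean g x = (\sum_(y <- nbrs x) g y) / 4.
Proof. by rewrite /nbrs !big_cons big_nil addr0 /nbr_mean !addrA. Qed.

Section LatticeChain.
Context {R : realType} {d : measure_display} {T : measurableType d}.
Variables (P : probability T R) (p : lattice -> lattice -> R).
Variables (x0 : lattice) (S : nat -> T -> lattice).
Hypothesis hS : is_markov_chain P p x0 S.
Hypothesis hp : forall x y, ~~ neighbours x y -> p x y = 0.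

Definition pr (A : set T) : R := fine (P A).

Lemma prE A : measurable A -> P A = (pr A)%:E.
Proof. by move=> mA; rewrite /pr fineK // fin_num_measure. Qed.

Lemma pr_split A B : measurable A -> measurable B ->
  pr A = pr (A `&` B) + pr (A `\` B).
Proof.
move=> mA mB; rewrite /pr (measureDI P mA mB) fineD ?fin_num_measure //; last 2 first.
- exact: measurableD.
- exact: measurableI.
by rewrite addrC.
Qed.

Lemma pr_le A B : measurable A -> measurable B -> A `<=` B -> pr A <= pr B.
Proof.
move=> mA mB AB; rewrite /pr fine_le ?fin_num_measure //.
by apply: le_measure => //; rewrite inE.
Qed.

Lemma pr_ge0 A : 0 <= pr A.
Proof. by rewrite fine_ge0. Qed.

Lemma measurable_chain i (B : set lattice) : measurable (S i @^-1` B).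
Proof.
have -> : S i @^-1` B = \bigcup_(z : lattice) (S i @^-1` ([set z] `&` B)).
  apply/seteqP; split => w /= => [h|[z _ /= [-> //]]].
  by exists (S i w).
apply: countable_bigcupT_measurable => [|z]; first exact: countableP.
have [zB|zB] := pselect (B z).
  rewrite setIidl; first exact: (markov_measurable hS).
  by move=> _ ->.
have -> : [set z] `&` B = set0 by apply/seteqP; split => // y [-> /zB].
by rewrite preimage_set0.
Qed.

(** Finite additivity over the prescribed values of one coordinate, with a
    remainder; the remainder is negligible when the values are the neighbours
    of the present position. *)
Lemma pr_split_seq A i (s : seq lattice) : measurable A -> uniq s ->
  pr A = \sum_(z <- s) pr (A `&` S i @^-1` [set z]) +
         pr (A `&` S i @^-1` [set z | z \notin s]).
Proof.
move=> mA; elim: s => [_|z s IH /andP[zs us]].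
  rewrite big_nil add0r; by congr pr; apply/seteqP; split => w /=; [move=> h; split|case].
rewrite (IH us) big_cons [pr _ + \sum_(_ <- _) _]addrC -addrA; congr (_ + _).
have mB B : measurable (A `&` S i @^-1` B).
  by apply: measurableI => //; exact: measurable_chain.
rewrite (@pr_split _ (S i @^-1` [set z])) //; last exact: measurable_chain.
congr (pr _ + pr _); apply/seteqP; split => w /=.
- by case=> [[]].
- by move=> [Aw ->].
- by case=> [[Aw h] /= hz]; split=> //; rewrite inE negb_or; apply/andP; split=> //; apply/eqP.
- by case=> Aw; rewrite inE negb_or => /andP[/eqP h1 h2].
Qed.

Definition cylinder (y : nat -> lattice) n : set T :=
  [set w | forall i, (i <= n)%N -> S i w = y i].

Lemma measurable_cylinder y n : measurable (cylinder y n).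
Proof.
have -> : cylinder y n = \bigcap_(i in [set i | (i <= n)%N]) (S i @^-1` [set y i]) by [].
by apply: bigcap_measurableType => i _; exact: measurable_chain.
Qed.

Lemma cylinderS y n z :
  pr (cylinder y n `&` S n.+1 @^-1` [set z]) = pr (cylinder y n) * p (y n) z.
Proof.
pose y' i := if (i <= n)%N then y i else z.
have := markov_step hS y' n.
have -> : [set w | forall i, (i <= n.+1)%N -> S i w = y' i] =
    cylinder y n `&` S n.+1 @^-1` [set z].
  apply/seteqP; split => w /=.
    move=> h; split=> [i hi|]; first by rewrite h /y' ?hi // leqW.
    by rewrite h // /y' ltnn.
  by move=> [h1 h2] i; rewrite leq_eqVlt /y' => /orP[/eqP ->|hi];
    [rewrite ltnn|rewrite -ltnS hi; apply: h1].
have -> : [set w | forall i, (i <= n)%N -> S i w = y' i] = cylinder y n.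
  by apply/seteqP; split => w /= h i hi; rewrite h // /y' hi.
rewrite /y' leqnn ltnn /pr => ->.
by rewrite fineM // ?fin_num_measure //; exact: measurable_cylinder.
Qed.

(** The jumps to non-neighbours are countably many null events. *)
Lemma pr_cylinder_far y n :
  pr (cylinder y n `&` S n.+1 @^-1` [set z | z \notin nbrs (y n)]) = 0.
Proof.
rewrite /pr; suff -> : P (cylinder y n `&` S n.+1 @^-1` [set z | z \notin nbrs (y n)]) = 0%E by [].
apply: measure_negligible.
  apply: measurableI; [exact: measurable_cylinder|exact: measurable_chain].
pose F (k : nat) : set T := if (choice.unpickle k : option lattice) is Some z then
  (if z \notin nbrs (y n) then cylinder y n `&` S n.+1 @^-1` [set z] else set0)
  else set0.
have nF : P.-negligible (\bigcup_k F k).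
  apply: negligible_bigcup => k; rewrite /F.
  case: (choice.unpickle k : option lattice) => [z|]; last exact: negligible_set0.
  case: ifP => hz; last exact: negligible_set0.
  have mz : measurable (cylinder y n `&` S n.+1 @^-1` [set z]).
    apply: measurableI; [exact: measurable_cylinder|exact: measurable_chain].
  have P0 : P (cylinder y n `&` S n.+1 @^-1` [set z]) = 0%E.
    by rewrite prE // cylinderS hp ?mulr0 // -mem_nbrs.
  by apply/negligibleP.
have sub : cylinder y n `&` S n.+1 @^-1` [set z | z \notin nbrs (y n)] `<=` \bigcup_k F k.
  move=> w /= [h1 h2]; exists (choice.pickle (S n.+1 w)); first exact: I.
  by rewrite /F choice.pickleK h2.
exact: negligibleS sub nF.
Qed.

Variables (B C : pred lattice).

(** Backward recursion for the probability that the next [m] positions are in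
    [B] and the last of them is in [C]. With [B] full and [C] a point it gives
    the [m]-step transition probabilities, with [C] full the avoidance
    probabilities. *)
Fixpoint stay_prob (m : nat) (x : lattice) : R :=
  if m is m'.+1 then \sum_(z <- nbrs x) p x z * (if B z then stay_prob m' z else 0)
  else (C x)%:R.

Definition stay_event y n m : set T :=
  cylinder y n `&` [set w | (forall i, (n < i <= n + m)%N -> B (S i w)) /\ C (S (n + m)%N w)].

Lemma measurable_stay y n m : measurable (stay_event y n m).
Proof.
apply: measurableI; first exact: measurable_cylinder.
have -> : [set w | (forall i, (n < i <= n + m)%N -> B (S i w)) /\ C (S (n + m)%N w)] =
  \bigcap_(i in [set i | (n < i <= n + m)%N]) (S i @^-1` [set z | B z]) `&`
  (S (n + m)%N @^-1` [set z | C z]) by [].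
apply: measurableI; last exact: measurable_chain.
by apply: bigcap_measurableType => i _; exact: measurable_chain.
Qed.

(** The cylinder is kept as a prefix of the event so that the induction on [m]
    can absorb one more prescribed position into it. *)
Lemma pr_stay y n m : pr (stay_event y n m) = pr (cylinder y n) * stay_prob m (y n).
Proof.
elim: m n y => [|m IH] n y.
  rewrite /stay_event addn0 /=.
  have [h|h] := boolP (C (y n)).
    rewrite mulr1; congr pr; apply/seteqP; split => w /=; first by case.
    by move=> hw; split=> //; split=> [i|]; [lia|rewrite hw].
  rewrite mulr0 [X in pr X](_ : _ = set0); first by rewrite /pr measure0.
  by apply/seteqP; split => w //= [hw [_]]; rewrite hw // (negPf h).
rewrite (pr_split_seq n.+1 (measurable_stay y n m.+1) (uniq_nbrs (y n))).
rewrite [X in _ + X](_ : _ = 0) ?addr0; last first.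
  apply/eqP; rewrite eq_le pr_ge0 andbT -(pr_cylinder_far y n).
  apply: pr_le; last by move=> w [[]].
    by apply: measurableI; [exact: measurable_stay|exact: measurable_chain].
  by apply: measurableI; [exact: measurable_cylinder|exact: measurable_chain].
rewrite /= mulr_sumr; apply: eq_bigr => z _.
pose y' i := if (i <= n)%N then y i else z.
have cyl' : cylinder y' n.+1 = cylinder y n `&` S n.+1 @^-1` [set z].
  apply/seteqP; split => w /=.
    move=> h; split=> [i hi|]; first by rewrite h /y' ?hi // leqW.
    by rewrite h // /y' ltnn.
  by move=> [h1 h2] i; rewrite leq_eqVlt /y' => /orP[/eqP ->|hi];
    [rewrite ltnn|rewrite -ltnS hi; apply: h1].
case: ifP => Bz; last first.
  rewrite !mulr0; suff -> : stay_event y n m.+1 `&` S n.+1 @^-1` [set z] = set0.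
    by rewrite /pr measure0.
  apply/seteqP; split => w //= [[_ [h _]] zw].
  by have := h n.+1; rewrite zw Bz => H; apply: (notF (H _)); lia.
have -> : stay_event y n m.+1 `&` S n.+1 @^-1` [set z] = stay_event y' n.+1 m.
  rewrite /stay_event cyl' addSnnS; apply/seteqP; split => w /=.
    move=> [[h1 [h2 h3]] h4]; split=> //; split=> // i hi; apply: h2; lia.
  move=> [[h1 h4] [h2 h3]]; split=> //; split=> //; split=> // i.
  have [->|ne] := eqVneq i n.+1; first by rewrite h4.
  by move=> hi; apply: h2; lia.
by rewrite IH cyl' cylinderS /y' ltnn mulrA.
Qed.

Lemma pr_stay_start m :
  pr [set w | (forall i, (0 < i <= m)%N -> B (S i w)) /\ C (S m w)] = stay_prob m x0.
Proof.
have h := pr_stay (fun=> x0) 0 m.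
have cyl : cylinder (fun=> x0) 0 = S 0%N @^-1` [set x0].
  apply/seteqP; split => w /=; first by move=> /(_ 0%N (leqnn _)).
  by move=> h' i; rewrite leqn0 => /eqP ->.
have c1 : pr (cylinder (fun=> x0) 0) = 1 by rewrite cyl /pr (markov_start hS).
rewrite c1 mul1r in h; rewrite -h /stay_event add0n.
set E := [set w | _].
have mE : measurable E.
  have -> : E = \bigcap_(i in [set i | (0 < i <= m)%N]) (S i @^-1` [set z | B z]) `&`
    (S m @^-1` [set z | C z]) by [].
  apply: measurableI; last exact: measurable_chain.
  by apply: bigcap_measurableType => i _; exact: measurable_chain.
have mc := measurable_cylinder (fun=> x0) 0.
rewrite (pr_split mE mc) setIC -[RHS]addr0; congr (_ + _).
apply/eqP; rewrite eq_le pr_ge0 andbT.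
have := pr_split (@measurableT _ T) mc; rewrite setTI c1 {1}/pr probability_setT /=.
have : pr (E `\` cylinder (fun=> x0) 0) <= pr (setT `\` cylinder (fun=> x0) 0).
  apply: pr_le; [exact: measurableD|exact: measurableD|by move=> w []].
lra.
Qed.

End LatticeChain.

Lemma srw_kernel (R : realType) (d : measure_display) (T : measurableType d)
  (Q : lattice -> probability T R) (S : nat -> T -> lattice) :
  is_simple_random_walk Q S -> potential_kernel Q S = pk R.
Proof.
move=> hS.
have hp x y : ~~ neighbours x y -> @srw_transition R x y = 0.
  by rewrite /srw_transition => /negPf ->.
have E x k : fine (Q x (S k @^-1` [set 0])) = walk2 R k x.
  have := pr_stay_start (hS x) hp predT (pred1 0) k.
  have -> : [set w | (forall i, (0 < i <= k)%N -> predT (S i w)) /\ pred1 0 (S k w)] =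
     S k @^-1` [set 0].
    by apply/seteqP; split => w /= => [[_ /eqP]|->].
  rewrite /pr => ->; elim: k x => [|k IH] x; first by rewrite walk2_0.
  rewrite walk2S nbr_meanE /= mulr_suml; apply: eq_big_seq => z.
  by rewrite mem_nbrs /srw_transition IH mulrC => ->.
apply/funext => x; rewrite /potential_kernel /pk /pk_series.
by under eq_fun do rewrite !E.
Qed.

(** * The conditioned walk as a chain on the lattice *)

Section ConditionedWalk.
Context {R : realType} {d : measure_display} {T : measurableType d}.
Variables (P : probability T R) (x0 : punctured_lattice).
Variable (Shat : nat -> T -> punctured_lattice).
Hypothesis hx0 : neighbours 0 (val x0).
Hypothesis hShat : is_markov_chain P (conditioned_transition (pk R)) x0 Shat.

Let p (x y : lattice) : R :=
  if neighbours x y then pk R y / (4 * pk R x) else 0.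
Let Z n w : lattice := val (Shat n w).

(** The origin is an admissible state for the transition function on the whole
    lattice because [a] vanishes there, so no jump leads to it. *)
Lemma conditioned_lattice_chain : is_markov_chain P p (val x0) Z.
Proof.
split.
- move=> k x; have [x0'|xn0] := eqVneq x 0.
    have -> : Z k @^-1` [set x] = set0.
      by apply/seteqP; split => w //=; rewrite /Z x0' => h; have := valP (Shat k w); rewrite /= h.
    exact: measurable0.
  have -> : Z k @^-1` [set x] = Shat k @^-1` [set exist (fun x => x != 0) x xn0].
    by apply/seteqP; split => w /=; [move=> h; apply: val_inj|rewrite /Z => ->].
  exact: (markov_measurable hShat).
- have -> : Z 0%N @^-1` [set val x0] = Shat 0%N @^-1` [set x0].
    by apply/seteqP; split => w /=; [move=> h; apply: val_inj|rewrite /Z => ->].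
  exact: (markov_start hShat).
- move=> y n.
  have Z0 i w : Z i w != 0 := valP (Shat i w).
  have [[i [hi yi]]|hy] := pselect (exists i, (i <= n)%N /\ y i = 0).
    have e m : (n <= m)%N -> [set w | forall i, (i <= m)%N -> Z i w = y i] = set0.
      move=> nm; apply/seteqP; split => w //= /(_ i (leq_trans hi nm)).
      by rewrite yi => h; have := Z0 i w; rewrite h eqxx.
    by rewrite !e // measure0 mul0e.
  have {}hy i : (i <= n)%N -> y i != 0.
    by move=> hi; apply/eqP => h; apply: hy; exists i.
  have [yS|yS] := eqVneq (y n.+1) 0.
    have -> : [set w | forall i, (i <= n.+1)%N -> Z i w = y i] = set0.
      apply/seteqP; split => w //= /(_ _ (leqnn _)).
      by rewrite yS => h; have := Z0 n.+1 w; rewrite h eqxx.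
    by rewrite measure0 yS /p pk0 mul0r if_same mule0.
  pose y' i : punctured_lattice := insubd x0 (y i).
  have y'E i : (i <= n.+1)%N -> val (y' i) = y i.
    rewrite leq_eqVlt => /orP[/eqP ->|hi]; rewrite /y' insubdK //.
    exact: hy.
  have e m : (m <= n.+1)%N -> [set w | forall i, (i <= m)%N -> Z i w = y i] =
      [set w | forall i, (i <= m)%N -> Shat i w = y' i].
    move=> mn; apply/seteqP; split => w /= h i hi.
      by apply: val_inj; rewrite y'E ?(leq_trans hi) //; apply: h.
    by rewrite /Z h // y'E // (leq_trans hi).
  rewrite !e // (markov_step hShat); congr (_ * _%:E)%E.
  by rewrite /conditioned_transition /p !y'E.
Qed.

Variable Y : seq lattice.
Hypothesis x0Y : val x0 \notin Y.

(** The Doob transform: the factors [a z / a x] telescope along a path. *)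
Lemma conditioned_stay m x : x \notin Y -> x != 0 ->
  stay_prob p (fun z => z \notin Y) predT m x * pk R x = avoid_pot R Y m x.
Proof.
elim: m x => [|m IH] x xY xn0; first by rewrite /= mul1r (negPf xY) (negPf xn0).
rewrite avoid_potS ?negb_or ?xY //= nbr_meanE !mulr_suml; apply: eq_big_seq => z.
rewrite mem_nbrs /p => xz; rewrite xz.
have ax := pk_gt0 R xn0.
have [->|zn0] := eqVneq z 0; first by rewrite pk0 mul0r !mul0r avoid_pot_kill ?eqxx ?orbT // mul0r.
have [zY|zY] := boolP (z \in Y); first by rewrite /= mulr0 mul0r avoid_pot_kill ?zY // mul0r.
by rewrite /= -IH //; field; rewrite gt_eqF.
Qed.

Definition avoids (w : T) : Prop := forall i, val (Shat i w) \notin Y.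

Lemma measurable_avoids : measurable [set w | avoids w].
Proof.
have -> : [set w | avoids w] = \bigcap_i (Z i @^-1` [set z | z \notin Y]).
  by apply/seteqP; split => w /= h i; [move=> _; exact: h|exact: (h i I)].
by apply: bigcapT_measurable => i; exact: (measurable_chain conditioned_lattice_chain).
Qed.

(** Avoidance at all times is the decreasing limit of avoidance up to time
    [n]; since [x0] is a neighbour of the origin, the normalisation [pk R (val
    x0)] is 1. *)
Lemma pr_avoids : fine (P [set w | avoids w]) = avoid_lim R Y (val x0).
Proof.
have mZ := measurable_chain conditioned_lattice_chain.
pose F n := [set w | forall i, (0 < i <= n)%N -> Z i w \notin Y].
have mF n : measurable (F n).
  have -> : F n = \bigcap_(i in [set i | (0 < i <= n)%N]) (Z i @^-1` [set z | z \notin Y]) by [].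
  by apply: bigcap_measurableType => i _; exact: mZ.
have hp x y : ~~ neighbours x y -> p x y = 0 by rewrite /p => /negPf ->.
have prF n : fine (P (F n)) = avoid_pot R Y n (val x0).
  have := pr_stay_start conditioned_lattice_chain hp (fun z => z \notin Y) predT n.
  rewrite -(conditioned_stay n x0Y (valP x0)) (pk_nbr0 R hx0) mulr1 /pr => <-.
  congr (fine (P _)); apply/seteqP; split => w /=; last by case.
  by move=> h; split.
have mG : measurable (\bigcap_n F n) by apply: bigcapT_measurable => i; exact: mF.
have cvgF : (fun n => fine (P (F n))) @ \oo --> fine (P (\bigcap_n F n)).
  apply: fine_cvg; rewrite fineK ?fin_num_measure //.
  apply: nonincreasing_cvg_mu => //.
    by rewrite ltey_eq fin_num_measure.
  apply/nonincreasing_seqP => n; apply/subsetPset => w h i hi; apply: h; lia.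
have e : fine (P [set w | avoids w]) = fine (P (\bigcap_n F n)).
  have -> : [set w | avoids w] = \bigcap_n F n `&` (Z 0%N @^-1` [set z | z \notin Y]).
    apply/seteqP; split => w /=.
      by move=> h; split=> [n _ i _|]; apply: h.
    by move=> [h1 h2] [|i] //; apply: (h1 i.+1) => //=; rewrite leqnn.
  have m0 := mZ 0%N [set z | z \notin Y].
  have h := pr_split P mG m0; rewrite /pr in h; rewrite h.
  suff -> : P (\bigcap_n F n `\` (Z 0%N @^-1` [set z | z \notin Y])) = 0%E by rewrite addr0.
  apply/eqP; rewrite eq_le measure_ge0 andbT.
  apply: (@le_trans _ _ (P (~` (Z 0%N @^-1` [set val x0])))).
    apply: le_measure; rewrite ?inE //.
    - exact: measurableD.
    - by apply: measurableC; exact: mZ.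
    - by move=> w [_ h'] /= zw; apply: h'; rewrite /= zw.
  rewrite probability_setC; last exact: mZ.
  by rewrite (markov_start conditioned_lattice_chain) subee.
rewrite e; apply/esym; apply: (cvg_lim _) => //.
by under eq_cvg do rewrite -prF.
Qed.

End ConditionedWalk.

(** * Tuples of points *)

Section Tuples.
Variable R : realType.

Fixpoint ktuples (T : Type) (s : seq T) k : seq (seq T) :=
  if k is k'.+1 then [seq y :: t | y <- s, t <- ktuples s k'] else [:: [::]].

Lemma size_ktuples (T : Type) (s : seq T) k : size (ktuples s k) = (size s ^ k)%N.
Proof. by elim: k => //= k IH; rewrite size_allpairs IH expnS. Qed.

Lemma big_ktuplesS (T : Type) (s : seq T) k (F : seq T -> R) :
  \sum_(t <- ktuples s k.+1) F t = \sum_(y <- s) \sum_(t <- ktuples s k) F (y :: t).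
Proof. by rewrite /= big_allpairs_dep. Qed.

Lemma expr_sum_ktuples (T : Type) (s : seq T) (f : T -> R) k :
  (\sum_(y <- s) f y) ^+ k = \sum_(t <- ktuples s k) \prod_(y <- t) f y.
Proof.
elim: k => [|k IH]; first by rewrite big_seq1 big_nil.
rewrite exprS IH big_ktuplesS mulr_suml; apply: eq_bigr => y _.
by rewrite mulr_sumr; apply: eq_bigr => t _; rewrite big_cons.
Qed.

Lemma mem_ktuples (T : eqType) (s : seq T) k t :
  t \in ktuples s k -> size t = k /\ {subset t <= s}.
Proof.
elim: k t => [|k IH] t /=; first by rewrite inE => /eqP ->.
move=> /allpairsP[[y u] /= [ys /IH[us uss] ->]]; split; first by rewrite /= us.
by move=> z; rewrite inE => /orP[/eqP ->|/uss].
Qed.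

(** A new point [y] spoils a separated tuple only if it is close to one of its
    entries or to [o], which has proportion at most [e] for each of them. The
    entries and [o] number [k + 1], and the sum of these numbers over the
    steps is at most [k ^ 2]. *)
Lemma bad_ktuples (T : eqType) (s : seq T) (sep : rel T) (o : T) (e : R) k :
  0 <= e -> symmetric sep ->
  (forall z, \sum_(y <- s) (~~ sep y z)%:R <= e * (size s)%:R) ->
  \sum_(t <- ktuples s k) (~~ pairwise sep (o :: t))%:R <=
    (k ^ 2)%:R * e * (size s)%:R ^+ k.
Proof.
move=> e0 sym hsep; elim: k => [|k IH]; first by rewrite big_seq1 /= !mul0r.
set m : R := (size s)%:R in hsep IH *.
rewrite big_ktuplesS.
apply: (@le_trans _ _ (\sum_(y <- s) \sum_(t <- ktuples s k)
  ((~~ pairwise sep (o :: t))%:R + \sum_(z <- o :: t) (~~ sep y z)%:R))).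
  apply: ler_sum => y _; apply: ler_sum => t _.
  have p0 : 0 <= \sum_(z <- o :: t) (~~ sep y z)%:R :> R by apply: sumr_ge0.
  have [/= h|h] := boolP (pairwise sep [:: o, y & t]); first by rewrite addr_ge0.
  have [h'|h'] := boolP (pairwise sep (o :: t)); last by rewrite /= lerDl.
  rewrite add0r.
  have [z zt hz] : exists2 z, z \in o :: t & ~~ sep y z.
    apply/hasP; rewrite has_predC; apply: contra h => hall.
    move: h' hall => /= /andP[h1 h2] /andP[h3 h4].
    by rewrite sym h3 h1 h4 h2.
  rewrite (big_rem z) //= hz /= lerDl; exact: sumr_ge0.
have -> : \sum_(y <- s) \sum_(t <- ktuples s k)
  ((~~ pairwise sep (o :: t))%:R + \sum_(z <- o :: t) (~~ sep y z)%:R) =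
  m * (\sum_(t <- ktuples s k) (~~ pairwise sep (o :: t))%:R) +
  \sum_(t <- ktuples s k) \sum_(z <- o :: t) \sum_(y <- s) (~~ sep y z)%:R :> R.
  under eq_bigr do rewrite big_split /=.
  rewrite big_split /= big_const_seq iter_addr_0 count_predT mulr_natl; congr (_ + _).
  rewrite exchange_big /=; apply: eq_bigr => t _; exact: exchange_big.
have h2 : \sum_(t <- ktuples s k) \sum_(z <- o :: t) \sum_(y <- s) (~~ sep y z)%:R
    <= k.+1%:R * e * m ^+ k.+1 :> R.
  apply: (@le_trans _ _ (\sum_(t <- ktuples s k) k.+1%:R * (e * m))).
    rewrite big_seq [leRHS]big_seq; apply: ler_sum => t /mem_ktuples[tk _].
    apply: (@le_trans _ _ (\sum_(z <- o :: t) e * m)); first exact: ler_sum.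
    by rewrite big_const_seq iter_addr_0 count_predT /= tk mulr_natl.
  rewrite big_const_seq iter_addr_0 count_predT size_ktuples -[leLHS]mulr_natr natrX exprS.
  by rewrite -/m !mulrA mulrAC.
have m0 : 0 <= m by [].
have h1 : m * (\sum_(t <- ktuples s k) (~~ pairwise sep (o :: t))%:R) <=
   (k ^ 2)%:R * e * m ^+ k.+1.
  apply: le_trans (ler_wpM2l m0 IH) _; rewrite exprS; lra.
apply: le_trans (lerD h1 h2) _.
rewrite -mulrDl -mulrDl -natrD; apply: ler_wpM2r; first exact: exprn_ge0.
apply: ler_wpM2r => //; rewrite ler_nat; lia.
Qed.

End Tuples.

(** * Lattice points of a dilated open set *)

Section LatticeDensity.
Variable R : realType.
Variable D : set (R * R).
Hypotheses (D0 : D !=set0) (Db : bounded_set D) (Do : open D).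
Local Notation A := (dilated_lattice_points D).

Lemma dilated_bounded : exists M : nat, forall n z, A n z -> (lnorm z <= M * n)%N.
Proof.
have [M0 [_ hM]] := Db.
have [M hM'] : exists M : nat, M0 < M%:R.
  exists (Num.bound (Num.max 0 M0)); apply: le_lt_trans (archi_boundP _); last first.
    by rewrite le_max lexx.
  by rewrite le_max lexx orbT.
exists (2 * M)%N => n [z1 z2] [[x1 x2] Dx] [e1 e2].
have : `|(x1, x2)| <= M%:R by exact: hM Dx.
rewrite /Num.norm /= ge_max => /andP[h1 h2].
have b (x : R) (z : int) : `|x| <= M%:R -> n%:R * x = z%:~R -> (`|z| <= M * n)%N.
  move=> hx e; rewrite -lez_nat abszE -(ler_int R) intr_norm -e normrM normr_nat.
  by rewrite PoszM intrM mulrC ler_wpM2r.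
have := b _ _ h1 e1; have := b _ _ h2 e2; rewrite /lnorm /=; lia.
Qed.

Lemma dilated_finite n : finite_set (A n).
Proof.
have [M hM] := dilated_bounded.
apply: (@sub_finite_set _ _ [set` box (M * n)]); last exact: finite_seq.
by move=> z /hM hz /=; exact: mem_box.
Qed.

(** The corner [z] is the integer part of [n] times the centre of a ball
    inside [D]; taking [K] at least twice the inverse of its radius absorbs
    the rounding. *)
Lemma dilated_square : exists K, [/\ (0 < K)%N & forall n, (K <= n)%N ->
  exists z : lattice, forall i j, (i < n %/ K)%N -> (j < n %/ K)%N ->
    A n (z.1 + i%:Z, z.2 + j%:Z)].
Proof.
have [[p q] Dpq] := D0.
have /nbhs_ballP[r /= r0 hr] : nbhs (p, q) D by apply: open_nbhs_nbhs; split.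
pose K := (Num.bound (2 / r)).+1.
have Kr : 2 <= r * K%:R.
  rewrite mulrC -ler_pdivrMr //; apply/ltW.
  apply: (@lt_le_trans _ _ (Num.bound (2 / r))%:R); last by rewrite ler_nat.
  by apply: archi_boundP; rewrite divr_ge0 // ltW.
exists K; split=> // n Kn.
have n0 : 0 < n%:R :> R by rewrite ltr0n; apply: leq_trans Kn.
exists (Num.floor (n%:R * p), Num.floor (n%:R * q)) => i j hi hj /=.
have H (x : R) l : (l < n %/ K)%N ->
    `|x - n%:R^-1 * (Num.floor (n%:R * x) + l%:Z)%:~R| < r.
  move=> hl; have /andP[f1 f2] := floor_itv (n%:R * x).
  rewrite intrD in f2.
  have lK : l%:R * K%:R + K%:R <= n%:R :> R.
    rewrite -natrM -natrD ler_nat.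
    have := leq_trunc_div n K; apply: leq_trans.
    by rewrite addnC -mulSn leq_mul2r hl orbT.
  have l0 : (0 : R) <= l%:R by [].
  have K1 : (1 : R) <= K%:R by rewrite ler1n.
  have Kn' : K%:R <= n%:R :> R by rewrite ler_nat.
  have rn : l%:R + 1 < n%:R * r.
    have : r * (l%:R * K%:R + K%:R) <= r * n%:R by apply: ler_wpM2l => //; exact: ltW.
    have : (r * K%:R - 2) * (l%:R + 1) >= 0 by apply: mulr_ge0; lra.
    lra.
  rewrite -(ltr_pM2l n0) -[X in X * `|_|](gtr0_norm n0) -normrM mulrBr mulVKf ?gt_eqF //.
  rewrite intrD -[l%:~R]/(l%:R : R) ltr_norml; apply/andP; split; lra.
exists (n%:R^-1 * (Num.floor (n%:R * p) + i%:Z)%:~R, n%:R^-1 * (Num.floor (n%:R * q) + j%:Z)%:~R).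
  by apply: hr; split; apply: H.
by congr (_, _); rewrite /GRing.scale /= mulVKf ?gt_eqF.
Qed.

Lemma count_near (s : seq lattice) (K n : nat) (z : lattice) : uniq s ->
  (0 < K)%N ->
  (\sum_(y <- s) ~~ (n <= K * lnorm (y - z)%R)%N <= (2 * (n %/ K)).+1 ^ 2)%N.
Proof.
move=> us K0.
have -> : (\sum_(y <- s) ~~ (n <= K * lnorm (y - z)%R)%N =
   size [seq (y - z)%R | y <- s & ~~ (n <= K * lnorm (y - z)%R)%N])%N.
  by rewrite size_map size_filter -sum1_count [RHS]big_mkcond /=; apply: eq_bigr => y _; case: (~~ _).
apply: (@leq_trans (size (box (n %/ K)))).
  apply: uniq_leq_size.
    by rewrite map_inj_uniq ?filter_uniq // => x y /addIr.
  move=> x /mapP[y]; rewrite mem_filter => /andP[h _] ->; apply: mem_box.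
  by rewrite leq_divRL // mulnC; lia.
by rewrite size_allpairs !size_iota.
Qed.

(** The points near [z] lie in a box of side [2 n / K], while the dilated set
    contains a square of side proportional to [n]: the proportion of near
    points is of order [1 / K ^ 2]. *)
Lemma dilated_density (e : R) : 0 < e -> exists K n0, forall n, (n0 <= n)%N ->
  let s : seq lattice := fset_set (A n) in
  [/\ (0 < size s)%N, (forall z, z \in s -> (lnorm z <= K * n)%N) &
   forall z, \sum_(y <- s) (~~ (n <= K * lnorm (y - z)%R)%N)%:R <= e * (size s)%:R].
Proof.
move=> e0; have [M hM] := dilated_bounded; have [K0 [K00 hK0]] := dilated_square.
pose K := (M + (Num.bound (36 * K0%:R ^+ 2 / e))).+1.
exists K, (K + K0)%N => n hn s.
have us : uniq s by exact: fset_uniq.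
have sA z : (z \in s) <-> A n z.
  have -> : (z \in s) = (z \in fset_set (A n)) by [].
  by rewrite in_fset_set ?inE //; exact: dilated_finite.
have ss : ((n %/ K0) ^ 2 <= size s)%N.
  have [z hz] : exists z : lattice, forall i j, (i < n %/ K0)%N -> (j < n %/ K0)%N ->
    A n (z.1 + i%:Z, z.2 + j%:Z) by apply: hK0; lia.
  have -> : ((n %/ K0) ^ 2 = size [seq (z.1 + i%:Z, z.2 + j%:Z)%R | i <- iota 0 (n %/ K0), j <- iota 0 (n %/ K0)])%N.
    by rewrite size_allpairs !size_iota.
  apply: uniq_leq_size.
    apply: allpairs_uniq; rewrite ?iota_uniq // => [[i j] [i' j']] _ _ /= [h1 h2].
    by congr (_, _); lia.
  move=> _ /allpairsP[[i j] [+ + ->]]; rewrite !mem_iota !add0n => /= hi hj.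
  by apply/sA; apply: hz.
have q1 : (0 < n %/ K0)%N by rewrite divn_gt0 //; lia.
split.
- by apply: leq_trans ss; rewrite expn_gt0 q1.
- move=> z /sA /hM h; apply: leq_trans h _; rewrite leq_mul2r; apply/orP; right.
  by rewrite /K; lia.
move=> z.
have c1 := @count_near s K n z us isT.
rewrite -natr_sum.
set c := (\sum_(y <- s) _)%N in c1 *.
have c2 : (c * K ^ 2 <= 36 * K0 ^ 2 * size s)%N.
  have r1 : (0 < n %/ K)%N by rewrite divn_gt0 //; lia.
  have r2 := leq_trunc_div n K.
  have r3 : (n <= 2 * (n %/ K0 * K0))%N.
    have := ltn_ceil n K00; rewrite mulSn => h.
    have : (K0 <= n %/ K0 * K0)%N by rewrite leq_pmull.
    lia.
  apply: (@leq_trans ((3 * (n %/ K)) ^ 2 * K ^ 2)%N).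
    rewrite leq_mul2r; apply/orP; right; apply: leq_trans c1 _.
    by rewrite leq_exp2r //; lia.
  rewrite -expnMn -mulnA.
  apply: (@leq_trans ((3 * n) ^ 2)%N); first by rewrite leq_exp2r // leq_mul2l r2 orbT.
  apply: (@leq_trans ((3 * (2 * (n %/ K0 * K0))) ^ 2)%N).
    by rewrite leq_exp2r // leq_mul2l r3 orbT.
  have -> : ((3 * (2 * (n %/ K0 * K0))) ^ 2 = 36 * K0 ^ 2 * (n %/ K0) ^ 2)%N.
    by rewrite !expnMn; lia.
  by rewrite leq_mul2l ss orbT.
have K1 : 1 <= K%:R :> R by rewrite ler1n.
have Ke : 36 * K0%:R ^+ 2 <= e * K%:R.
  rewrite [leRHS]mulrC -ler_pdivrMr //; apply: ltW.
  apply: (@lt_le_trans _ _ (Num.bound (36 * K0%:R ^+ 2 / e))%:R).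
    by apply: archi_boundP; rewrite divr_ge0 ?(ltW e0) // mulr_ge0 // sqr_ge0.
  by rewrite ler_nat /K; lia.
have c3 : c%:R * K%:R ^+ 2 <= 36 * K0%:R ^+ 2 * (size s)%:R :> R.
  by rewrite -!natrX -!natrM ler_nat.
have s0 : (0 : R) <= (size s)%:R by [].
have k2 : 36 * K0%:R ^+ 2 * (size s)%:R <= e * K%:R * (size s)%:R by apply: ler_wpM2r.
have k3 : e * K%:R * (size s)%:R <= e * (size s)%:R * K%:R ^+ 2.
  rewrite mulrAC expr2; apply: ler_wpM2l; first by rewrite mulr_ge0 // ltW.
  by rewrite -[leLHS]mulr1; apply: ler_wpM2l => //; lra.
have K2 : 0 < K%:R ^+ 2 :> R by rewrite exprn_gt0 //; lra.
rewrite -(ler_pM2r K2).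
exact: le_trans c3 (le_trans k2 k3).
Qed.

End LatticeDensity.

(** * Integrals of bounded functions *)

Section RintegralFiniteMeasure.
Context {R : realType} {d : measure_display} {T : measurableType d}.
Variables (mu : {measure set T -> \bar R}) (D : set T).
Hypotheses (mD : measurable D) (muD : (mu D < +oo)%E).

Lemma bounded_integrable (f : T -> R) (B : R) : measurable_fun D f ->
  (forall x, D x -> `|f x| <= B) -> mu.-integrable D (EFin \o f).
Proof.
move=> mf hB; apply: measurable_bounded_integrable => //.
exists B; split; first exact: num_real.
by move=> M BM x Dx; apply: le_trans (hB _ Dx) (ltW BM).
Qed.

Lemma Rintegral_sum (I : eqType) (s : seq I) (F : I -> T -> R) :
  (forall i, i \in s -> mu.-integrable D (EFin \o F i)) ->
  mu.-integrable D (EFin \o (fun x => \sum_(i <- s) F i x)) /\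
  \int[mu]_(x in D) (\sum_(i <- s) F i x) = \sum_(i <- s) \int[mu]_(x in D) F i x.
Proof.
elim: s => [_|i s IH hF].
  have e : (fun x => \sum_(i <- [::]) F i x) = cst 0 by apply/funext => x; rewrite big_nil.
  rewrite e big_nil; split; last by rewrite Rintegral_cst // mul0r.
  by apply: (@bounded_integrable _ 0) => [|x _]; [exact: measurable_cst|rewrite normr0].
have [h1 h2] := IH (fun j js => hF j (mem_behead (s := i :: s) js)).
have hi := hF i (mem_head _ _).
have e : (fun x => \sum_(j <- i :: s) F j x) = (fun x => F i x + \sum_(j <- s) F j x).
  by apply/funext => x; rewrite big_cons.
rewrite e; split.
  rewrite (_ : _ \o _ = (EFin \o F i) \+ (EFin \o (fun x => \sum_(j <- s) F j x))) //.
  exact: integrableD.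
by rewrite RintegralD // h2 big_cons.
Qed.

Lemma integrable_indic_lin (A : set T) (c e : R) : measurable A ->
  mu.-integrable D (EFin \o (fun x => c + e * \1_A x)) /\
  \int[mu]_(x in D) (c + e * \1_A x) = c * fine (mu D) + e * fine (mu (A `&` D)).
Proof.
move=> mA.
have h1 : mu.-integrable D (EFin \o (fun x => \1_A x : R)).
  apply: (@bounded_integrable _ 1); first exact: measurable_indic.
  by move=> x _; rewrite indicE; case: (x \in A); rewrite /= ?normr1 ?normr0.
have h2 : mu.-integrable D (EFin \o (fun x => e * \1_A x : R)).
  rewrite (_ : _ \o _ = (fun x => e%:E * (EFin \o (fun x => \1_A x : R)) x)%E) //.
  exact: integrableZl.
have h3 : mu.-integrable D (EFin \o (fun _ => c)).
  by apply: (@bounded_integrable _ `|c|) => //; exact: measurable_cst.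
split.
  rewrite (_ : _ \o _ = (EFin \o (fun _ => c)) \+ (EFin \o (fun x => e * \1_A x : R))) //.
  exact: integrableD.
rewrite RintegralD // RintegralZl // Rintegral_cst //.
by rewrite /Rintegral integral_indic.
Qed.

Variable f : T -> R.
Hypotheses (mf : measurable_fun D f) (f01 : forall x, D x -> 0 <= f x <= 1).

Lemma integrable_pow c k : mu.-integrable D (EFin \o (fun x => c * f x ^+ k)).
Proof.
apply: (@bounded_integrable _ `|c|).
  by apply: measurable_funM; [exact: measurable_cst|exact: measurable_funX].
move=> x /f01 /andP[f0 f1]; rewrite normrM -[leRHS]mulr1; apply: ler_wpM2l => //.
by rewrite ger0_norm ?exprn_ge0 // exprn_ile1.
Qed.

Lemma Rintegral_horner (p : {poly R}) :
  mu.-integrable D (EFin \o (fun x => p.[f x])) /\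
  \int[mu]_(x in D) p.[f x] =
  \sum_(i <- iota 0 (size p)) p`_i * \int[mu]_(x in D) (f x ^+ i).
Proof.
have e : (fun x => p.[f x]) = (fun x => \sum_(i <- iota 0 (size p)) p`_i * f x ^+ i).
  apply/funext => x; rewrite horner_coef -(big_mkord xpredT (fun i => p`_i * f x ^+ i)).
  by rewrite /index_iota subn0.
have [h1 h2] := @Rintegral_sum _ (iota 0 (size p)) (fun i x => p`_i * f x ^+ i)
  (fun i _ => integrable_pow _ _).
rewrite e; split=> //; rewrite h2; apply: eq_bigr => i _.
rewrite RintegralZl //.
have := integrable_pow 1 i; rewrite (_ : (fun x => 1 * f x ^+ i) = fun x => f x ^+ i) //.
by apply/funext => x; rewrite mul1r.
Qed.

End RintegralFiniteMeasure.

(** * Polynomials close to the indicator of an interval *)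

Section ThresholdPolynomial.
Variable R : realType.

Lemma bernoulli_ge (y : R) n : 0 <= y <= 1 -> 1 - n%:R * y <= (1 - y) ^+ n.
Proof.
move=> /andP[y0 y1]; elim: n => [|n IH]; first by rewrite mul0r subr0 expr0.
rewrite exprS -natr1.
have n0 : (0 : R) <= n%:R by [].
have : (1 - y) * (1 - n%:R * y) <= (1 - y) * (1 - y) ^+ n by apply: ler_wpM2l => //; lra.
have : 0 <= n%:R * y * y by rewrite !mulr_ge0.
lra.
Qed.

Lemma bernoulli_le (y : R) n : 0 <= y <= 1 -> (1 - y) ^+ n * (n%:R * y) <= 1.
Proof.
move=> /andP[y0 y1].
have h : 1 + n%:R * y <= (1 + y) ^+ n.
  elim: n => [|n IH]; first by rewrite mul0r addr0 expr0.
  rewrite exprS -natr1.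
  have n0 : (0 : R) <= n%:R by [].
  have : (1 + y) * (1 + n%:R * y) <= (1 + y) * (1 + y) ^+ n by apply: ler_wpM2l => //; lra.
  have : 0 <= n%:R * y * y by rewrite !mulr_ge0.
  lra.
have p : 0 <= (1 - y) ^+ n by rewrite exprn_ge0 // subr_ge0.
apply: (@le_trans _ _ ((1 - y) ^+ n * (1 + y) ^+ n)).
  by apply: ler_wpM2l => //; apply: le_trans h; rewrite lerDr.
rewrite -exprMn; apply: exprn_ile1; nra.
Qed.

(** The polynomial is [(1 - 'X^n) ^+ N] with [N] about [r ^- n] for a
    threshold [r] between [s] and [t]. Bernoulli's inequality bounds it below
    by [1 - N x^n], which is near 1 for [x <= s], and above by [1 / (N x^n)],
    which is near 0 for [t <= x]. *)
Lemma threshold_poly (s t e : R) : 0 <= s -> s < t -> t <= 1 -> 0 < e ->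
  exists q : {poly R}, forall x, 0 <= x <= 1 ->
    [/\ 0 <= q.[x] <= 1, x <= s -> 1 - e <= q.[x] & t <= x -> q.[x] <= e].
Proof.
move=> s0 st t1 e0; pose r := (s + t) / 2.
have r0 : 0 < r by rewrite /r; lra.
have r1 : r <= 1 by rewrite /r; lra.
have sr : s < r by rewrite /r; lra.
have rt : r < t by rewrite /r; lra.
have t0 : 0 < t by lra.
clearbody r.
have [n [hn1 hn2]] : exists n, 2 * (s / r) ^+ n <= e /\ (r / t) ^+ n <= e.
  have c1 : (fun n => (s / r) ^+ n) @ \oo --> (0 : R).
    apply: cvg_expr; have h0 : 0 <= s / r by rewrite divr_ge0 // ltW.
    by rewrite (ger0_norm h0) ltr_pdivrMr // mul1r.
  have c2 : (fun n => (r / t) ^+ n) @ \oo --> (0 : R).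
    apply: cvg_expr; have h0 : 0 <= r / t by rewrite divr_ge0 // ltW.
    by rewrite (ger0_norm h0) ltr_pdivrMr // mul1r.
  have e2 : 0 < e / 2 by rewrite divr_gt0.
  move/cvgrPdist_le : c1 => /(_ _ e2) c1; move/cvgrPdist_le : c2 => /(_ _ e0) c2.
  have [N _ hN] := filterI c1 c2.
  exists N; have [/= h1 h2] := hN N (leqnn N).
  move: h1 h2; rewrite !sub0r !normrN => h1 h2; split.
    by have := le_trans (ler_norm _) h1; lra.
  exact: le_trans (ler_norm _) h2.
pose N := (Num.truncn (r ^- n)).+1.
have rn0 : 0 < r ^+ n by rewrite exprn_gt0.
have rnV : 1 <= r ^- n by rewrite invf_ge1 // exprn_ile1 // ltW.
have /andP[N1 N2] : r ^- n <= N%:R <= 2 * r ^- n.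
  have /andP[h1 h2] := Num.Theory.truncn_itv (le_trans ler01 rnV).
  by rewrite ltW //= /N -natr1; lra.
exists ((1 - 'X^n) ^+ N) => x /andP[x0 x1].
(* compare x^n with s^n or t^n, knowing that N r^n is between 1 and 2 *)
have -> : ((1 - 'X^n) ^+ N).[x] = (1 - x ^+ n) ^+ N by rewrite !hornerE.
have y01 : 0 <= x ^+ n <= 1 by rewrite exprn_ge0 // exprn_ile1.
case/andP: (y01) => y0 y1.
split.
- by apply/andP; split; [rewrite exprn_ge0 // subr_ge0|apply: exprn_ile1; lra].
- move=> xs; apply: le_trans (bernoulli_ge N y01).
  rewrite lerD2l lerN2; apply: le_trans hn1.
  have xs' : x ^+ n <= s ^+ n by rewrite lerXn2r ?nnegrE // (le_trans x0).
  have h : N%:R * x ^+ n <= 2 * r ^- n * s ^+ n by apply: ler_pM.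
  by apply: le_trans h _; rewrite expr_div_n mulrA mulrAC.
move=> tx; have h := bernoulli_le N y01.
have tn : 0 < t ^+ n by rewrite exprn_gt0.
have p : 0 <= (1 - x ^+ n) ^+ N by rewrite exprn_ge0 // subr_ge0.
apply: le_trans hn2; rewrite expr_div_n ler_pdivlMr //.
have k : t ^+ n <= N%:R * x ^+ n * r ^+ n.
  rewrite -ler_pdivrMr // mulrC; apply: ler_pM => //.
  - by rewrite invr_ge0 ltW.
  - exact: ltW.
  - by rewrite lerXn2r ?nnegrE ?(ltW t0).
rewrite -[leRHS]mul1r; apply: (@le_trans _ _ ((1 - x ^+ n) ^+ N * (N%:R * x ^+ n) * r ^+ n)).
  by rewrite -mulrA; apply: ler_wpM2l.
by apply: ler_wpM2r => //; exact: ltW.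
Qed.

End ThresholdPolynomial.

Fact threshold_arith (R : realFieldType) (s t e I J pa pb : R) :
  (1 - e) * s <= I -> I <= t + e -> (1 - e) * pa <= J -> J <= pb + e ->
  e * pa <= e * 1 -> e * s <= e * 1 -> - e <= I - J -> I - J <= e ->
  pa <= t + 3 * e /\ s - 3 * e <= pb.
Proof. by move=> *; split; lra. Qed.

(** * From moments to the uniform law *)

Section MomentProblem.
Variable R : realType.
Local Notation mu := (@lebesgue_measure R).

Lemma Rintegral_pow01 k : \int[mu]_(x in `[0, 1]) (x ^+ k) = k.+1%:R^-1 :> R.
Proof.
rewrite -beta_fun1Sn beta_fun_sym /beta_fun -Rintegral_mkcond.
by apply: eq_Rintegral => x _; rewrite XMonemXn0.
Qed.

Context {d : measure_display} {T : measurableType d} (P : probability T R).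
Variable X : nat -> T -> R.
Hypotheses (mX : forall n, measurable_fun setT (X n))
  (X01 : forall n w, 0 <= X n w <= 1)
  (hX : forall k, (fun n => \int[P]_w (X n w ^+ k)) @ \oo --> (k.+1%:R^-1 : R)).

Let PT : (P setT < +oo)%E.
Proof. by rewrite probability_setT ltry. Qed.

Let mu01 : (mu `[0%R, 1%R]%classic < +oo)%E.
Proof. by rewrite lebesgue_measure_itv /= lte01 sube0 ltry. Qed.

Lemma measurable_le_event n r : measurable [set w | X n w <= r].
Proof.
have -> : [set w | X n w <= r] = setT `&` X n @^-1` `]-oo, r].
  by rewrite setTI; apply/seteqP; split => w /=; rewrite in_itv.
exact: mX.
Qed.

Let mid : measurable_fun (`[0%R, 1%R]%classic : set (measurableTypeR R)) (fun x => x : R).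
Proof. exact: measurable_id. Qed.

Lemma poly_moment_cvg (q : {poly R}) :
  (fun n => \int[P]_w q.[X n w]) @ \oo --> \int[mu]_(x in `[0, 1]) q.[x].
Proof.
have id01 (x : R) : x \in `[0, 1]%classic -> 0 <= x <= 1 by rewrite inE /= in_itv.
have [_ ->] := @Rintegral_horner R _ _ mu `[0, 1]%classic (measurable_itv _) mu01 (fun x => x)
  mid (fun x h => id01 x (mem_set h)) q.
have e n : \int[P]_w q.[X n w] = \sum_(i <- iota 0 (size q)) q`_i * \int[P]_w (X n w ^+ i).
  by have [_ ->] := @Rintegral_horner R _ _ P setT measurableT PT (X n) (mX n) (fun w _ => X01 n w) q.
have -> : (fun n => \int[P]_w q.[X n w]) =
    (fun n => \sum_(i <- iota 0 (size q)) q`_i * \int[P]_w (X n w ^+ i)) by apply/funext.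
elim: (iota _ _) => [|i s IH].
  rewrite big_nil (_ : (fun n => _) = cst 0); first exact: cvg_cst.
  by apply/funext => n; rewrite big_nil.
rewrite big_cons (_ : (fun n => _) = (fun n => q`_i * \int[P]_w (X n w ^+ i)) \+
  (fun n => \sum_(j <- s) q`_j * \int[P]_w (X n w ^+ j))).
  by apply: cvgD IH; apply: cvgMr; rewrite Rintegral_pow01.
by apply/funext => n; rewrite big_cons.
Qed.

Lemma lebesgue_le_event (s : R) : 0 <= s <= 1 ->
  fine (mu ([set x | x <= s] `&` `[0, 1]%classic)) = s.
Proof.
move=> /andP[s0 s1].
have -> : [set x | x <= s] `&` `[0, 1]%classic = `[0, s]%classic.
  apply/seteqP; split => x /=; rewrite !in_itv /=.
    by move=> [-> /andP[->]].
  by move=> /andP[-> xs]; split=> //; apply: le_trans xs s1.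
rewrite lebesgue_measure_itv /= lte_fin; case: ltP => h /=.
  by rewrite subr0.
by apply/eqP; rewrite eq_le h s0.
Qed.

(** A threshold polynomial sandwiches the distribution function between
    expectations of polynomials, which converge because the moments do; the
    same sandwich holds for Lebesgue measure on the unit interval. *)
Lemma moments_to_uniform (r : R) : 0 <= r <= 1 ->
  (fun n => fine (P [set w | X n w <= r])) @ \oo --> r.
Proof.
move=> /andP[r0 r1].
have p1 A : measurable A -> 0 <= fine (P A) <= 1.
  move=> mA; rewrite fine_ge0 //= -lee_fin fineK ?fin_num_measure //.
  exact: probability_le1.
have P1 : fine (P setT) = 1 by rewrite probability_setT.
have mu1 : fine (mu `[0%R, 1%R]%classic) = 1 by rewrite lebesgue_measure_itv /= lte01 sube0.
have m01 : measurable (`[0%R, 1%R]%classic : set (measurableTypeR R)) by exact: measurable_itv.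
have mle (s : R) : measurable ([set x | x <= s] : set (measurableTypeR R)).
  by have -> : [set x | x <= s] = `]-oo, s]%classic;
    [apply/seteqP; split => x /=; rewrite in_itv|exact: measurable_itv].
have id01 (x : R) : `[0, 1]%classic x -> 0 <= x <= 1 by rewrite /= in_itv.
have key (s t e : R) : 0 <= s -> s < t -> t <= 1 -> 0 < e -> \forall n \near \oo,
    fine (P [set w | X n w <= s]) <= t + 3 * e /\
    s - 3 * e <= fine (P [set w | X n w <= t]).
  move=> s0 st t1 e0.
  have [q hq] := threshold_poly s0 st t1 e0.
  have iq n := (@Rintegral_horner R _ _ P setT measurableT PT (X n) (mX n) (fun w _ => X01 n w) q).1.
  have imq := (@Rintegral_horner R _ _ mu `[0, 1]%classic m01 mu01 (fun x => x) mid id01 q).1.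
  have [j1 e1] := @integrable_indic_lin R _ _ mu `[0, 1]%classic m01 mu01 _ 0 (1 - e) (mle s).
  have [j2 e2] := @integrable_indic_lin R _ _ mu `[0, 1]%classic m01 mu01 _ e 1 (mle t).
  have lo : (1 - e) * s <= \int[mu]_(x in `[0, 1]) q.[x].
    apply: (@le_trans _ _ (\int[mu]_(x in `[0, 1]) (0 + (1 - e) * \1_[set x | x <= s] x))).
      by rewrite e1 mul0r add0r lebesgue_le_event // s0 (le_trans (ltW st) t1).
    apply: le_Rintegral => // x x01; rewrite add0r indicE.
    have [/andP[q0 q1] q2 _] := hq _ (id01 _ x01).
    have [xs|xs] := boolP (x \in _); last by rewrite mulr0.
    by rewrite mulr1; apply: q2; move: xs; rewrite inE.
  have up : \int[mu]_(x in `[0, 1]) q.[x] <= t + e.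
    apply: (@le_trans _ _ (\int[mu]_(x in `[0, 1]) (e + 1 * \1_[set x | x <= t] x))); last first.
      have t01 : 0 <= t <= 1 by rewrite t1 (le_trans s0 (ltW st)).
      by rewrite e2 mu1 lebesgue_le_event // mulr1 mul1r addrC.
    apply: le_Rintegral => // x x01; rewrite mul1r indicE.
    have [/andP[q0 q1] _ q2] := hq _ (id01 _ x01).
    have [xs|xs] := boolP (x \in _); first by rewrite (le_trans q1) // lerDr ltW.
    rewrite addr0; apply: q2; move: xs; rewrite notin_setE /= => /negP; rewrite -ltNge; exact: ltW.
  have := @poly_moment_cvg q; move/cvgrPdist_le => /(_ _ e0); apply: filterS => n hn.
  have ms := @measurable_le_event n s; have mt := measurable_le_event n t.
  have [k1 f1] := @integrable_indic_lin R _ _ P setT measurableT PT _ 0 (1 - e) ms.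
  have [k2 f2] := @integrable_indic_lin R _ _ P setT measurableT PT _ e 1 mt.
  rewrite setIT in f1; rewrite setIT P1 in f2.
  have lo' : (1 - e) * fine (P [set w | X n w <= s]) <= \int[P]_w q.[X n w].
    rewrite -[leLHS]add0r -(mul0r (fine (P setT))) -f1.
    apply: le_Rintegral => // w _; rewrite add0r indicE.
    have [/andP[q0 q1] q2 _] := hq _ (X01 n w).
    have [xs|xs] := boolP (w \in _); last by rewrite mulr0.
    by rewrite mulr1; apply: q2; move: xs; rewrite inE.
  have up' : \int[P]_w q.[X n w] <= fine (P [set w | X n w <= t]) + e.
    apply: (@le_trans _ _ (\int[P]_w (e + 1 * \1_[set w | X n w <= t] w))); last first.
      by rewrite f2 mulr1 mul1r addrC.
    apply: le_Rintegral => // w _; rewrite mul1r indicE.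
    have [/andP[q0 q1] _ q2] := hq _ (X01 n w).
    have [xs|xs] := boolP (w \in _); first by rewrite (le_trans q1) // lerDr ltW.
    rewrite addr0; apply: q2; move: xs; rewrite notin_setE /= => /negP; rewrite -ltNge; exact: ltW.
  have /andP[a0 a1] := p1 _ ms; have /andP[b0 b1] := p1 _ mt.
  have ea : e * fine (P [set w | X n w <= s]) <= e * 1 by apply: ler_wpM2l => //; exact: ltW.
  have es : e * s <= e * 1 by apply: ler_wpM2l; [exact: ltW|exact: le_trans (ltW st) t1].
  move: hn; rewrite ler_norml => /andP[h1 h2].
  exact: threshold_arith lo up lo' up' ea es h1 h2.
apply/cvgrPdist_le => e e0.
clear mu1 P1.
have U : \forall n \near \oo, fine (P [set w | X n w <= r]) <= r + e.
  have [r1'|r1'] := ltP r 1; last first.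
    by apply: nearW => n; have /andP[_ h] := p1 _ (@measurable_le_event n r); lra.
  pose t := Num.min 1 (r + e / 4).
  have t1 : t <= 1 by rewrite ge_min lexx.
  have t2 : t <= r + e / 4 by rewrite ge_min lexx orbT.
  have rt : r < t by rewrite lt_min r1' /=; lra.
  have e4 : 0 < e / 4 by lra.
  by apply: filterS (key _ _ _ r0 rt t1 e4) => n [h _]; lra.
have L : \forall n \near \oo, r - e <= fine (P [set w | X n w <= r]).
  have [r0'|r0'] := ltP 0 r; last first.
    by apply: nearW => n; have /andP[h _] := p1 _ (@measurable_le_event n r); lra.
  pose s := Num.max 0 (r - e / 4).
  have s1 : 0 <= s by rewrite le_max lexx.
  have s2 : r - e / 4 <= s by rewrite le_max lexx orbT.
  have sr : s < r by rewrite gt_max r0' /=; lra.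
  have e4 : 0 < e / 4 by lra.
  by apply: filterS (key _ _ _ s1 sr r1 e4) => n [_ h]; lra.
apply: filterS2 U L => n h1 h2; rewrite ler_norml; apply/andP; split; lra.
Qed.

End MomentProblem.

(** * Moments of the vacant fraction *)

Lemma lnorm_nbr0 x : neighbours 0 x -> lnorm x = 1%N.
Proof. by rewrite /neighbours /lnorm /=; lia. Qed.

Lemma lnormB x y : lnorm (x - y) = lnorm (y - x).
Proof. by rewrite /lnorm /=; lia. Qed.

Lemma lnorm0 : lnorm 0 = 0%N.
Proof. by []. Qed.

Section VacantMoments.
Context {R : realType} {d : measure_display} {T : measurableType d}.
Variables (P : probability T R) (x0 : punctured_lattice).
Variable (Shat : nat -> T -> punctured_lattice).
Hypothesis hx0 : neighbours 0 (val x0).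
Hypothesis hShat : is_markov_chain P (conditioned_transition (pk R)) x0 Shat.

Definition vacancy (s : seq lattice) (w : T) : R :=
  (\sum_(y <- s) \1_[set w | avoids Shat [:: y] w] w) / (size s)%:R.

Lemma avoids_cons y t : [set w | avoids Shat (y :: t) w] =
  [set w | avoids Shat [:: y] w] `&` [set w | avoids Shat t w].
Proof.
apply/seteqP; split => w /=.
  by move=> h; split=> i; have := h i; rewrite !inE negb_or => /andP[h1 h2].
by move=> [h1 h2] i; rewrite inE negb_or h2; have := h1 i; rewrite inE => ->.
Qed.

Lemma prod_indic_avoids t w :
  \prod_(y <- t) \1_[set w | avoids Shat [:: y] w] w =
  \1_[set w | avoids Shat t w] w :> R.
Proof.
elim: t => [|y t IH]; first by rewrite big_nil indicE mem_set.
by rewrite big_cons IH (avoids_cons y t) !indicE in_setI -natrM mulnb.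
Qed.

Lemma mavoids t : measurable [set w | avoids Shat t w].
Proof. exact: (measurable_avoids hShat). Qed.

Lemma measurable_vacancy s : measurable_fun setT (vacancy s).
Proof.
apply: measurable_funM; last exact: measurable_cst.
by apply: measurable_sum => y; apply: measurable_indic; exact: mavoids.
Qed.

Lemma vacancy01 s w : 0 <= vacancy s w <= 1.
Proof.
have ind01 A : 0 <= (\1_A w : R) <= 1 by rewrite indicE; case: (w \in A); rewrite /= ?lexx ?ler01.
rewrite /vacancy; apply/andP; split.
  by apply: divr_ge0 => //; apply: sumr_ge0 => y _; case/andP: (ind01 [set w | avoids Shat [:: y] w]).
have [->|s0] := eqVneq s [::]; first by rewrite big_nil mul0r ler01.
have s1 : 0 < (size s)%:R :> R by rewrite ltr0n; case: (s) s0.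
rewrite ler_pdivrMr // mul1r.
apply: (@le_trans _ _ (\sum_(y <- s) 1)).
  by apply: ler_sum => y _; case/andP: (ind01 [set w | avoids Shat [:: y] w]).
by rewrite big_const_seq iter_addr_0 count_predT.
Qed.

Let PT : (P setT < +oo)%E.
Proof. by rewrite probability_setT ltry. Qed.

(** Expand the power of the sum of indicators over tuples; a product of
    avoidance indicators is the indicator of avoiding the whole tuple. *)
Lemma vacancy_moment s k : \int[P]_w (vacancy s w ^+ k) =
  (\sum_(t <- ktuples s k) fine (P [set w | avoids Shat t w])) / (size s)%:R ^+ k.
Proof.
have e w : vacancy s w ^+ k = (size s)%:R ^- k *
    \sum_(t <- ktuples s k) (0 + 1 * \1_[set w | avoids Shat t w] w).
  rewrite /vacancy exprMn exprVn mulrC expr_sum_ktuples; congr (_ * _).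
  by apply: eq_bigr => t _; rewrite prod_indic_avoids add0r mul1r.
have h t := @integrable_indic_lin R _ _ P setT measurableT PT _ 0 1 (mavoids t).
have [h1 h2] := @Rintegral_sum R _ _ P setT measurableT PT _ (ktuples s k)
  (fun t w => 0 + 1 * \1_[set w | avoids Shat t w] w) (fun t _ => (h t).1).
have -> : \int[P]_w (vacancy s w ^+ k) = \int[P]_w ((size s)%:R ^- k *
    \sum_(t <- ktuples s k) (0 + 1 * \1_[set w | avoids Shat t w] w)).
  by apply: eq_Rintegral => w _; exact: e.
rewrite RintegralZl // h2 mulrC; congr (_ / _); apply: eq_bigr => t _.
by rewrite (h t).2 mul0r add0r mul1r setIT.
Qed.

Variable D : set (R * R).
Hypotheses (D0 : D !=set0) (Db : bounded_set D) (Do : open D).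
Local Notation A := (dilated_lattice_points D).

(** Separated tuples, those that are pairwise [sep] together with the origin,
    contribute about [1 / (k + 1)] each by [avoid_asymp]; the others are a
    small proportion by [bad_ktuples]. *)
Lemma vacancy_moment_cvg k :
  (fun n => \int[P]_w (vacancy (fset_set (A n)) w ^+ k)) @ \oo --> (k.+1%:R^-1 : R).
Proof.
apply/cvgrPdist_le => e e0.
pose e' := e / (2 * (k ^ 2).+1%:R).
have e'0 : 0 < e' by rewrite divr_gt0 // mulr_gt0.
have e2 : 0 < e / 2 by rewrite divr_gt0.
have [K [n0 hK]] := dilated_density D0 Db Do e'0.
have [N0 hN] := avoid_asymp k K.+1 e2.
near=> n.
have nn0 : (n0 <= n)%N by near: n; exact: nbhs_infty_ge.
have nN0 : (N0 <= n)%N by near: n; exact: nbhs_infty_ge.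
have nK : (K.+1 < n)%N by near: n; exact: nbhs_infty_gt.
have [s0 sK sd] := hK n nn0.
set s : seq lattice := fset_set (A n) in s0 sK sd *.
pose sep : rel lattice := fun y z => (n <= K.+1 * lnorm (y - z)%R)%N.
have symsep : symmetric sep.
  by move=> y z; rewrite /sep lnormB.
have sd' z : \sum_(y <- s) (~~ sep y z)%:R <= e' * (size s)%:R.
  apply: le_trans (sd z); apply: ler_sum => y _; rewrite ler_nat /sep.
  have [h|h] := boolP (n <= K * lnorm (y - z)%R)%N; last by case: (~~ _).
  by rewrite (leq_trans h) // leq_mul2r leqnSn orbT.
have bad := bad_ktuples 0 k (ltW e'0) symsep sd'.
rewrite vacancy_moment distrC.
set m : R := (size s)%:R.
have m0 : 0 < m by rewrite ltr0n.
have mk : 0 < m ^+ k by rewrite exprn_gt0.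
set c : R := k.+1%:R^-1.
have c01 : 0 <= c <= 1 by rewrite invr_ge0 ler0n /= invf_le1 // ler1n.
case/andP: c01 => c0 c1.
pose p t := fine (P [set w | avoids Shat t w]).
have p01 t : 0 <= p t <= 1.
  rewrite fine_ge0 //= -lee_fin fineK ?fin_num_measure //; last exact: mavoids.
  exact: probability_le1 (mavoids t).
have pt t : t \in ktuples s k -> `|p t - c| <= e / 2 + (~~ pairwise sep (0 :: t))%:R.
  move=> tk; have [h|h] := boolP (pairwise sep (0 :: t)); last first.
    rewrite /=; have /andP[a b] := p01 t.
    rewrite ler_norml; apply/andP; split; lra.
  rewrite addr0; have [tk' ts] := mem_ktuples tk.
  move: h => /= /andP[h1 h2].
  have sep0 y : y \in t -> (n <= K.+1 * lnorm y)%N.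
    by move=> /(allP h1); rewrite /sep lnormB subr0.
  have sepxx : irreflexive sep.
    move=> y; rewrite /sep subrr lnorm0 muln0 leqn0.
    by apply/eqP => n_eq0; rewrite n_eq0 in nK.
  have ut : uniq t by exact: pairwise_uniq h2.
  rewrite /p (pr_avoids hx0 hShat); last first.
    by apply/negP => /sep0; rewrite (lnorm_nbr0 hx0) muln1 leqNgt nK.
  apply: (hN n) => // [y yt|y y' yt yt' yy'].
    split; last exact: sep0.
    by apply: leq_trans (sK _ (ts _ yt)) _; rewrite leq_mul2r leqnSn orbT.
  have hp : {in t &, forall y z, y != z -> sep y z}.
    elim: (t) h2 => //= a u IH /andP[ha hu] y1 y2.
    rewrite !inE => /orP[/eqP ->|y1u] /orP[/eqP ->|y2u] ne.
    - by rewrite eqxx in ne.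
    - exact: (allP ha).
    - by rewrite symsep; exact: (allP ha).
    - exact: IH.
  exact: hp.
have sumc : \sum_(t <- ktuples s k) c = c * m ^+ k.
  by rewrite big_const_seq iter_addr_0 count_predT size_ktuples -[LHS]mulr_natr natrX.
have -> : (\sum_(t <- ktuples s k) p t) / m ^+ k - c =
   (\sum_(t <- ktuples s k) (p t - c)) / m ^+ k.
  by rewrite sumrB sumc mulrBl mulfK // gt_eqF.
rewrite normrM normfV (gtr0_norm mk) ler_pdivrMr //.
apply: (le_trans (ler_norm_sum _ _ _)).
apply: (@le_trans _ _ (\sum_(t <- ktuples s k) (e / 2 + (~~ pairwise sep (0 :: t))%:R))).
  by rewrite big_seq [leRHS]big_seq; apply: ler_sum => t /pt.
rewrite big_split /=.
have -> : \sum_(t <- ktuples s k) (e / 2) = e / 2 * m ^+ k.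
  by rewrite big_const_seq iter_addr_0 count_predT size_ktuples -[LHS]mulr_natr natrX.
apply: le_trans (lerD (lexx _) bad) _.
rewrite -mulrDl; apply: ler_wpM2r; first exact: ltW.
have k0 : (0 : R) <= (k ^ 2)%:R by [].
have : (k ^ 2)%:R * e' <= e / 2.
  rewrite /e' -(natr1 (k ^ 2)) mulrA ler_pdivrMr; last by lra.
  have : 0 <= (k ^ 2)%:R * e by rewrite mulr_ge0 // ltW.
  by lra.
by lra.
Unshelve. all: by end_near.
Qed.

End VacantMoments.

(** * Convergence to the uniform law *)

Section UniformLimit.
Variable R : realType.
Local Notation mu := (@lebesgue_measure R).
Local Notation U := (uniform_prob (@ltr01 R)).

Lemma uniform_probE (E : set (measurableTypeR R)) : measurable E ->
  U E = mu (E `&` `[0, 1]%classic).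
Proof.
move=> mE; rewrite /uniform_prob integral_uniform_pdf.
rewrite (eq_integral (fun=> 1%E)); last first.
  move=> x; rewrite inE /= => -[_]; rewrite in_itv /= => x01.
  by rewrite /uniform_pdf x01 subr0 invr1.
by rewrite integral_cst ?mul1e //; apply: measurableI.
Qed.

Lemma cvg_uniform (d : measure_display) (T : measurableType d)
  (P : probability T R) (X : nat -> T -> R) :
  (forall n, measurable_fun setT (X n)) ->
  (forall n w, 0 <= X n w <= 1) ->
  (forall r, 0 <= r <= 1 -> (fun n => fine (P [set w | X n w <= r])) @ \oo --> r) ->
  cvg_in_distribution P X U.
Proof.
move=> mX X01 hX; split=> // r _.
have e n : X n @^-1` [set` `]-oo, r]] = [set w | X n w <= r].
  by apply/seteqP; split => w /=; rewrite in_itv.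
have Ir : [set` `]-oo, r]] = [set x | x <= r] by apply/seteqP; split => x /=; rewrite in_itv.
suff H : (fun n => P [set w | X n w <= r]) @ \oo --> mu ([set x | x <= r] `&` `[0, 1]%classic).
  rewrite -Ir -(uniform_probE (measurable_itv _)) in H.
  by rewrite (_ : (fun n => _) = (fun n => P [set w | X n w <= r])) //; apply/funext => n; rewrite e.
have [r0|r0] := ltP r 0.
  have -> : (fun n => P [set w | X n w <= r]) = cst 0%E.
    apply/funext => n; rewrite (_ : [set w | _] = set0) ?measure0 //.
    by apply/seteqP; split => w //= h; have /andP[h0 _] := X01 n w; move: (le_lt_trans (le_trans h0 h) r0); rewrite ltxx.
  rewrite (_ : _ `&` _ = set0) ?measure0; first exact: cvg_cst.
  by apply/seteqP; split => x //= [h]; rewrite in_itv /= => /andP[h0 _]; move: (le_lt_trans (le_trans h0 h) r0); rewrite ltxx.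
have [r1|r1] := leP r 1; last first.
  have -> : (fun n => P [set w | X n w <= r]) = cst 1%E.
    apply/funext => n; rewrite (_ : [set w | _] = setT) ?probability_setT //.
    by apply/seteqP; split => w //= _; have /andP[_ h1] := X01 n w; exact: ltW (le_lt_trans h1 r1).
  rewrite (_ : _ `&` _ = `[0, 1]%classic).
    by rewrite lebesgue_measure_itv /= lte01 sube0; exact: cvg_cst.
  by apply/seteqP; split => x /=; rewrite in_itv /=; [case|move=> /andP[h0 h1]; rewrite h0 h1; split=> //; exact: ltW (le_lt_trans h1 r1)].
have r01 : 0 <= r <= 1 by rewrite r0 r1.
have mE n : measurable [set w | X n w <= r] by rewrite -e -[_ @^-1` _]setTI; exact: mX.
have -> : mu ([set x | x <= r] `&` `[0, 1]%classic) = r%:E.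
  have fm : mu ([set x | x <= r] `&` `[0, 1]%classic) \is a fin_num.
    have mI : measurable ([set x | x <= r] `&` `[0, 1]%classic : set (measurableTypeR R)).
      by rewrite -Ir; apply: measurableI; exact: measurable_itv.
    have m1 : measurable (`[0, 1]%classic : set (measurableTypeR R)) by exact: measurable_itv.
    rewrite ge0_fin_numE //; apply: (@le_lt_trans _ _ (mu `[0%R, 1%R]%classic)).
      by apply: le_measure; [rewrite inE|rewrite inE|exact: subIsetr].
    by rewrite lebesgue_measure_itv /= lte01 sube0 ltry.
  by rewrite -[LHS]fineK // lebesgue_le_event.
apply: cvg_EFin; last exact: hX.
by apply: nearW => n; rewrite fin_num_measure.
Qed.

End UniformLimit.

(** * The visited and the vacant fraction *)

Section Fractions.
Context {R : realType} {d : measure_display} {T : measurableType d}.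
Variable Shat : nat -> T -> punctured_lattice.

Lemma walk_range_avoids w y : ~ walk_range Shat w y <-> avoids Shat [:: y] w.
Proof.
split=> [h i|h [i _ e]].
  by rewrite inE; apply/eqP => e; apply: h; exists i.
by have := h i; rewrite inE e eqxx.
Qed.

Lemma card_fset_set_filter (A B : set lattice) : finite_set A ->
  #|` fset_set (A `&` B)| = count (fun y => y \in B) (fset_set A).
Proof.
move=> fA; rewrite -size_filter; apply: perm_size; apply: uniq_perm.
- exact: fset_uniq.
- by rewrite filter_uniq // fset_uniq.
move=> y; rewrite mem_filter.
have -> : (y \in (fset_set (A `&` B) : seq lattice)) = (y \in fset_set (A `&` B)) by [].
have -> : (y \in (fset_set A : seq lattice)) = (y \in fset_set A) by [].
rewrite !in_fset_set //; last exact: finite_setIl.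
by rewrite in_setI andbC.
Qed.

Lemma vacant_fractionE (A : set lattice) w : finite_set A ->
  @vacant_fraction R _ Shat A w = vacancy (R := R) Shat (fset_set A) w.
Proof.
move=> fA; rewrite /vacant_fraction /vacancy setDE card_fset_set_filter //; congr (_ / _).
rewrite -sum1_count big_mkcond natr_sum; apply: eq_bigr => y _.
rewrite indicE; have -> : (y \in ~` walk_range Shat w) = (w \in [set w | avoids Shat [:: y] w]).
  by apply/idP/idP; rewrite !inE => h; apply/walk_range_avoids.
by case: (w \in _).
Qed.

Lemma visited_fractionE (A : set lattice) w : finite_set A ->
  (0 < size (fset_set A))%N ->
  @visited_fraction R _ Shat A w = 1 - vacancy (R := R) Shat (fset_set A) w.
Proof.
move=> fA A0; rewrite -vacant_fractionE // /vacant_fraction /visited_fraction.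
rewrite setDE !card_fset_set_filter //.
set s : seq lattice := fset_set A.
have -> : count (fun y => y \in ~` walk_range Shat w) s = (size s - count (fun y => y \in walk_range Shat w) s)%N.
  rewrite -(count_predC (fun y => y \in walk_range Shat w) s) addKn.
  by apply: eq_count => y /=; rewrite in_setC.
have s0 : (size s)%:R != 0 :> R by rewrite pnatr_eq0 -lt0n.
by rewrite natrB ?count_size // mulrBl divff // opprB addrC subrK.
Qed.

End Fractions.

Theorem corollary1p3 (R : realType)
  (* the simple random walk S, under the law Q x of the walk started at x *)
  (d : measure_display) (Omega : measurableType d)
  (Q : lattice -> probability Omega R) (S : nat -> Omega -> lattice)
  (hS : is_simple_random_walk Q S)
  (* the conditioned walk Shat, started at a fixed neighbour x0 of the origin *)
  (d' : measure_display) (Omega' : measurableType d')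
  (P : probability Omega' R) (Shat : nat -> Omega' -> punctured_lattice)
  (x0 : punctured_lattice) (hx0 : neighbours 0 (val x0))
  (hShat : is_markov_chain P
             (conditioned_transition (potential_kernel Q S)) x0 Shat)
  (D : set (R * R)) (D_nonempty : D !=set0) (D_bounded : bounded_set D)
  (D_open : open D) :
  [/\ \forall n \near \oo, dilated_lattice_points D n !=set0,
      cvg_in_distribution P
        (fun n => @visited_fraction R _ Shat (dilated_lattice_points D n))
        (uniform_prob (@ltr01 R)) &
      cvg_in_distribution P
        (fun n => @vacant_fraction R _ Shat (dilated_lattice_points D n))
        (uniform_prob (@ltr01 R))].
Proof.
rewrite (srw_kernel hS) in hShat.
pose A := dilated_lattice_points D.
have fA n : finite_set (A n) by exact: dilated_finite.
have [K0 [n0 dens]] := dilated_density D_nonempty D_bounded D_open (@ltr01 R).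
have A0 n : (n0 <= n)%N -> (0 < size (fset_set (A n)))%N.
  by move=> /dens [].
pose V n w : R := vacancy Shat (fset_set (A n)) w.
have mV n : measurable_fun setT (V n) by exact: (measurable_vacancy hShat).
have V01 n w : 0 <= V n w <= 1 by exact: vacancy01.
have momV := vacancy_moment_cvg hx0 hShat D_nonempty D_bounded D_open.
have vacE n : @vacant_fraction R _ Shat (A n) = V n.
  by apply/funext => w; rewrite vacant_fractionE.
split.
- exists n0 => // n /= nn0; have := A0 n nn0.
  case e : (fset_set (A n) : seq lattice) => [//|z s] _; exists z.
  have : z \in fset_set (A n).
    by rewrite -[z \in _]/(z \in (fset_set (A n) : seq lattice)) e mem_head.
  by rewrite in_fset_set // inE.
- pose X n w : R := @visited_fraction R _ Shat (A n) w.
  have XE n w : (n0 <= n)%N -> X n w = 1 - V n w.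
    by move=> nn0; rewrite /X visited_fractionE // A0.
  (* with no lattice point in the dilated set the fraction is 0 / 0 = 0 *)
  have XE' n w : X n w = if size (fset_set (A n)) == 0%N then 0 else 1 - V n w.
    case: ifP => h; last by rewrite /X visited_fractionE // lt0n h.
    rewrite /X /visited_fraction.
    by rewrite -[#|` fset_set (A n)|]/(size (fset_set (A n))) (eqP h) invr0 mulr0.
  have X01 n w : 0 <= X n w <= 1.
    rewrite XE'; case: ifP => _; first by rewrite lexx ler01.
    by have /andP[h1 h2] := V01 n w; rewrite subr_ge0 h2 gerBl h1.
  have mX n : measurable_fun setT (X n).
    have -> : X n = fun w => if size (fset_set (A n)) == 0%N then 0 else 1 - V n w.
      by apply/funext => w; exact: XE'.
    case: (size _ == 0%N); first exact: measurable_cst.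
    by apply: measurable_funB => //; exact: measurable_cst.
  apply: cvg_uniform => //; apply: moments_to_uniform => // k.
  (* the moments of the visited fraction are the expectations of (1 - V)^k *)
  have := @poly_moment_cvg R _ _ P V mV V01 momV ((1 - 'X) ^+ k).
  have -> : \int[@lebesgue_measure R]_(x in `[0, 1]) ((1 - 'X) ^+ k).[x] = k.+1%:R^-1.
    by rewrite -Rintegral_onemXn; apply: eq_Rintegral => x _; rewrite !hornerE.
  apply: cvg_trans; apply: near_eq_cvg; exists n0 => // n /= nn0.
  by apply: eq_Rintegral => w _; rewrite !hornerE -(XE n w nn0).
- rewrite (_ : (fun n => _) = V); last by apply/funext.
  by apply: cvg_uniform => //; exact: moments_to_uniform.
Qed.
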